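(* Under the non-degeneracy assumption below, the Mixing method applied to the diagonally constrained SDP $\min_{X\succeq 0}\langle C,X\rangle$ subject to $X_{ii}=1$, $i=1,\ldots,n$, is strictly decreasing in objective value and always converges to a first-order critical point.
   Context: Let $C\in\mathbb{R}^{n\times n}$ be a symmetric cost matrix, and without loss of generality $c_{ii}=0$. The SDP is solved in the low-rank form $\min_{V\in\mathbb{R}^{k\times n}} f(V)=\langle C, V^TV\rangle$ subject to $\|v_i\|=1$ for $i=1,\ldots,n$, where $v_i$ is the $i$-th column of $V$ and $\|\cdot\|$ is the Euclidean norm. The Mixing method initializes each $v_i$ on the unit sphere and cyclically, for $i=1,\ldots,n$, performs the update $v_i := -\sum_{j} c_{ij}v_j \,/\, \|\sum_j c_{ij}v_j\|$ (always using the most recent values of the $v_j$). Non-degeneracy assumption: for all $i$, the norms $\|\sum_{j=1}^n c_{ij}v_j\|$ computed during the procedure are always at least a constant $\delta>0$.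
   Formalization: Strict decrease of the objective is stated per full sweep and only for sweeps that change V (otherwise it is non-increasing): if the method sits at a fixed point, e.g. n=2, k=1, c12=1, V=(1,-1), the objective stays constant. *)

(* Defs.v *)
From HB Require Import structures.
From mathcomp Require Import all_boot all_order all_algebra.
From mathcomp Require Import all_classical all_reals all_analysis.
Set Implicit Arguments. Unset Strict Implicit. Unset Printing Implicit Defensive.
Import Order.TTheory GRing.Theory Num.Theory.
Local Open Scope ring_scope.

Section Mixing.
Variables (R : realType) (k n : nat).

Definition vnorm (v : 'cV[R]_k) : R := Num.sqrt (\sum_(l < k) v l 0 ^+ 2).

Definition obj (C : 'M[R]_n) (V : 'M[R]_(k, n)) : R :=
  \sum_(i < n) \sum_(j < n) C i j * (V^T *m V) i j.

Definition unit_cols (V : 'M[R]_(k, n)) : Prop :=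
  forall i : 'I_n, vnorm (col i V) = 1.

Definition gvec (C : 'M[R]_n) (V : 'M[R]_(k, n)) (i : 'I_n) : 'cV[R]_k :=
  \sum_(j < n) C i j *: col j V.

Definition mix_update (C : 'M[R]_n) (V : 'M[R]_(k, n)) (i : 'I_n) : 'M[R]_(k, n) :=
  let u := - ((vnorm (gvec C V i))^-1 *: gvec C V i) in
  \matrix_(a < k, b < n) (if b == i then u a 0 else V a b).

Definition mix_inner (C : 'M[R]_n) (V : 'M[R]_(k, n)) (i : 'I_n) : 'M[R]_(k, n) :=
  foldl (mix_update C) V (take i (enum 'I_n)).

Definition mix_sweep (C : 'M[R]_n) (V : 'M[R]_(k, n)) : 'M[R]_(k, n) :=
  foldl (mix_update C) V (enum 'I_n).

Definition mix_iter (C : 'M[R]_n) (V0 : 'M[R]_(k, n)) (r : nat) : 'M[R]_(k, n) :=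
  iter r (mix_sweep C) V0.

(* First-order (KKT) critical point of min <C,V^T V> s.t. ||v_i|| = 1:
   V is feasible and there are multipliers lambda_i with
   grad_{v_i} f = 2 g_i(V) = 2 lambda_i v_i. *)
Definition first_order_critical (C : 'M[R]_n) (V : 'M[R]_(k, n)) : Prop :=
  unit_cols V /\
  exists lam : 'I_n -> R, forall i : 'I_n, gvec C V i = lam i *: col i V.

End Mixing.

(* Main.v *)
Require Import Defs.
From HB Require Import structures.
From mathcomp Require Import all_boot all_order all_algebra.
From mathcomp Require Import all_classical all_reals all_analysis.
From mathcomp Require Import polyrcf ordered_qelim.
From mathcomp Require qe_rcf.
From mathcomp Require Import ring lra.
Import Order.TTheory GRing.Theory Num.Theory numFieldNormedType.Exports.
Set Implicit Arguments. Unset Strict Implicit. Unset Printing Implicit Defensive.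
Local Open Scope classical_set_scope.
Local Open Scope ring_scope.

(* A single update of v_i decreases f by |g_i| |v_i - v_i'|^2, so a sweep
   V -> V' satisfies f(V) - f(V') >= c |V - V'|^2, while the Riemannian gradient
   of f at V is O(|V - V'|).  These two estimates alone do not exclude that the
   iterates drift along a continuum of critical points; a Lojasiewicz-type
   argument is needed.

   Let m(t) be the least squared gradient norm G on the level {f = t} of the
   product of spheres, and x(t) a point of that level, chosen by successively
   minimizing G and all the coordinates.  By quantifier elimination over real
   closed fields, x(t) and m(t) are semialgebraic, hence monotone on an interval
   (a, a + eps), where a is the limit of f along the iterates.  There,
   t - s <= (K sqrt m(s) + L |x(t) - x(s)|) |x(t) - x(s)| for s < t, and
   subdividing gives t - s <= K sqrt m(t) |x(t) - x(s)|_1.  With s = f(V') and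
   t = f(V), m(t) <= G(V) = O(|V - V'|^2) yields
   |V - V'| = O(|x(f(V)) - x(f(V'))|_1).  The right-hand sides telescope because
   the coordinates of x are monotone and bounded, so the iterates have finite
   length and converge. *)

(** * Definable subsets of the line *)

Section Tame.
Variable R : realType.
Implicit Types (P Q : R -> Prop) (p : {poly R}).

Definition tame P : Prop := exists Z : seq R, forall x y, x <= y ->
  (forall z, z \in Z -> ~~ (x <= z <= y)) -> (P x <-> P y).

Lemma tame_ext P Q : (forall x, P x <-> Q x) -> tame P -> tame Q.
Proof.
move=> PQ [Z hZ]; exists Z => x y xy h.
by have := hZ x y xy h; have := PQ x; have := PQ y; tauto.
Qed.

Lemma tame_const (A : Prop) : tame (fun=> A).
Proof. by exists [::]. Qed.

Lemma tame_not P : tame P -> tame (fun x => ~ P x).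
Proof. by move=> [Z hZ]; exists Z => x y xy /(hZ _ _ xy); tauto. Qed.

Lemma tame_and P Q : tame P -> tame Q -> tame (fun x => P x /\ Q x).
Proof.
move=> [Z hZ] [Y hY]; exists (Z ++ Y) => x y xy h.
have /(hZ _ _ xy) : forall z, z \in Z -> ~~ (x <= z <= y).
  by move=> z zZ; apply: h; rewrite mem_cat zZ.
have /(hY _ _ xy) : forall z, z \in Y -> ~~ (x <= z <= y).
  by move=> z zY; apply: h; rewrite mem_cat zY orbT.
tauto.
Qed.

Lemma tame_or P Q : tame P -> tame Q -> tame (fun x => P x \/ Q x).
Proof.
move=> /tame_not tP /tame_not tQ.
have := tame_not (tame_and tP tQ); apply: tame_ext => x.
by have := EM (P x); have := EM (Q x); tauto.
Qed.

Lemma tame_poly_eq0 p : tame (fun x => p.[x] = 0).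
Proof.
have [->|p0] := eqVneq p 0; first by exists [::] => x y; rewrite !horner0.
exists (rootsR p) => x y xy h.
have nr z : x <= z <= y -> p.[z] <> 0.
  move=> xzy pz; have := h z; rewrite xzy -(roots_on_rootsR p0 z) in_itv.
  by rewrite rootE pz eqxx => /(_ isT).
by split=> pz; exfalso; move: pz; apply: nr; rewrite lexx ?andbT.
Qed.

Lemma tame_poly_lt0 p : tame (fun x => p.[x] < 0).
Proof.
have [Z hZ] := tame_poly_eq0 p.
exists Z => x y xy h.
have sub u v : x <= u -> u <= v -> v <= y -> (p.[u] = 0 <-> p.[v] = 0).
  move=> xu uv vy; apply: hZ => // z /h; apply: contra => /andP[uz zv].
  by rewrite (le_trans xu)// (le_trans zv).
have Exy := sub x y (lexx _) xy (lexx _).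
have ivt q : (forall u, p.[u] = 0 <-> q.[u] = 0) -> q.[x] <= 0 <= q.[y] ->
    p.[x] = 0.
  move=> pq /(poly_ivt xy)[z /andP[xz zy] /rootP/pq pz].
  by apply/(sub x z).
split=> px; rewrite ltNge; apply/negP => py.
- have x0 : p.[x] = 0 by apply: (ivt p) => //; rewrite (ltW px).
  by move: px; rewrite x0 ltxx.
- have /(iffLR Exy) y0 : p.[x] = 0.
    apply: (ivt (- p)); last by rewrite !hornerN oppr_le0 py oppr_ge0 (ltW px).
    move=> u; rewrite hornerN.
    by split=> [->|/eqP]; rewrite ?oppr0// oppr_eq0 => /eqP.
  by move: px; rewrite y0 ltxx.
Qed.

Lemma rterm_poly (t : GRing.term R) : GRing.rterm t ->
  exists p, forall x, GRing.eval [:: x] t = p.[x].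
Proof.
elim: t => //=.
- move=> [|n] _; first by exists 'X => x; rewrite hornerX.
  by exists 0 => x; rewrite horner0 nth_default.
- by move=> a _; exists a%:P => x; rewrite hornerC.
- by move=> n _; exists n%:R%:P => x; rewrite hornerC.
- move=> s IHs t IHt /andP[/IHs[p hp] /IHt[q hq]].
  by exists (p + q) => x; rewrite hp hq hornerD.
- by move=> s IHs /IHs[p hp]; exists (- p) => x; rewrite hp hornerN.
- by move=> s IHs n /IHs[p hp]; exists (p *+ n) => x; rewrite hp hornerMn.
- move=> s IHs t IHt /andP[/IHs[p hp] /IHt[q hq]].
  by exists (p * q) => x; rewrite hp hq hornerM.
- by move=> s IHs n /IHs[p hp]; exists (p ^+ n) => x; rewrite hp horner_exp.
Qed.

Lemma tame_qf (f : ord.formula R) : ord.qf_form f -> ord.rformula f ->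
  tame (fun x => ord.qf_eval [:: x] f).
Proof.
have sub2 (s t : GRing.term R) : GRing.rterm s && GRing.rterm t ->
    exists p, forall x, GRing.eval [:: x] s - GRing.eval [:: x] t = p.[x].
  move=> /andP[/rterm_poly[p hp] /rterm_poly[q hq]].
  by exists (p - q) => x; rewrite hp hq !hornerE.
have lt2 (s t : GRing.term R) : GRing.rterm s && GRing.rterm t ->
    tame (fun x => GRing.eval [:: x] s < GRing.eval [:: x] t).
  move=> /sub2[p hp]; apply: tame_ext (tame_poly_lt0 p) => x.
  by rewrite -hp subr_lt0.
elim: f => //=.
- by move=> b _ _; apply: tame_const.
- move=> s t _ /sub2[p hp]; apply: tame_ext (tame_poly_eq0 p) => x.
  rewrite -hp; split=> [/eqP|/eqP ->]; rewrite ?subrr//.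
  by rewrite subr_eq0.
- by move=> s t _; apply: lt2.
- move=> s t _; rewrite andbC => /lt2/tame_not; apply: tame_ext => x.
  by rewrite leNgt; split=> /negP.
- move=> f IHf g IHg /andP[/IHf{}IHf /IHg{}IHg] /andP[/IHf tf /IHg tg].
  by apply: tame_ext (tame_and tf tg) => x; split=> /andP.
- move=> f IHf g IHg /andP[/IHf{}IHf /IHg{}IHg] /andP[/IHf tf /IHg tg].
  by apply: tame_ext (tame_or tf tg) => x; split=> /orP.
- move=> f IHf g IHg /andP[/IHf{}IHf /IHg{}IHg] /andP[/IHf tf /IHg tg].
  apply: tame_ext (tame_or (tame_not tf) tg) => x; split.
    by move=> [/negP/negbTE ->//|->]; rewrite implybT.
  by move=> /implyP h; case: (ord.qf_eval _ f) h; [right; apply: h|left].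
- move=> f IHf /IHf{}IHf /IHf/tame_not; apply: tame_ext => x.
  by split=> /negP.
Qed.

Lemma tame_holds (f : ord.formula R) : tame (fun x => ord.holds [:: x] f).
Proof.
have rf := ord.to_rform_rformula f.
have /andP[qf rqf] := ord.quantifier_elim_wf (@qe_rcf.wf_QE_wproj R) rf.
apply: tame_ext (tame_qf qf rqf) => x.
rewrite -ord.to_rformP.
have qeP := ord.quantifier_elim_rformP (@qe_rcf.wf_QE_wproj R)
  (@qe_rcf.valid_QE_wproj R) [:: x] rf.
by split=> /qeP.
Qed.

Lemma seq_gap_right (Z : seq R) (t : R) :
  exists2 u, t < u & forall z, z \in Z -> ~~ (t < z < u).
Proof.
elim: Z => [|a Z [u tu IH]]; first by exists (t + 1); rewrite ?ltrDl.
case: (ltP t a) => ta.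
- exists (Num.min a u); first by rewrite lt_min ta.
  move=> z; rewrite inE lt_min => /orP[/eqP ->|/IH]; first by rewrite ltxx andbF.
  by rewrite andbA andbAC => /negbTE ->.
- exists u => // z; rewrite inE => /orP[/eqP ->|/IH//].
  by rewrite ltNge ta.
Qed.

Lemma tame_right P t : tame P -> exists2 u, t < u &
  (forall s, t < s < u -> P s) \/ (forall s, t < s < u -> ~ P s).
Proof.
move=> [Z hZ]; have [u tu hu] := seq_gap_right Z t; exists u => //.
have E s s' : t < s < u -> t < s' < u -> (P s <-> P s').
  wlog ss' : s s' / s <= s'.
    move=> W h h'; case: (leP s s') => ss'; first exact: W.
    by have [] := W _ _ (ltW ss') h' h; split.
  move=> /andP[ts _] /andP[_ su]; apply: hZ => // z /hu; apply: contra.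
  by move=> /andP[sz zs']; rewrite (lt_le_trans ts)// (le_lt_trans zs').
pose m := (t + u) / 2.
have mtu : t < m < u by rewrite /m; lra.
by case: (EM (P m)) => Pm; [left|right] => s /(E _ _ mtu); tauto.
Qed.

Lemma tame_left P t : tame P -> exists2 u, u < t &
  (forall s, u < s < t -> P s) \/ (forall s, u < s < t -> ~ P s).
Proof.
move=> [Z hZ]; have [|u tu h] := @tame_right (fun x => P (- x)) (- t).
  exists (map -%R Z) => x y xy h.
  have [] : P (- y) <-> P (- x); last by split.
  apply: hZ; first by rewrite lerN2.
  move=> z zZ; have := h _ (map_f -%R zZ).
  by rewrite lerNr lerNl andbC.
exists (- u); first by rewrite ltrNl.
have E s : - u < s < t -> - t < - s < u by rewrite ltrN2 ltrNl andbC.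
by case: h => h; [left|right] => s /E/h; rewrite opprK.
Qed.
End Tame.

(** * Definability *)

Section Definable.
Variable R : realType.
Implicit Types (P Q : (nat -> R) -> Prop) (e : nat -> R).

Definition upd e i x : nat -> R := fun j => if j == i then x else e j.

Definition definable P : Prop :=
  exists f : ord.formula R, forall s : seq R, ord.holds s f <-> P (nth 0 s).

Definition term_fun (F : (nat -> R) -> R) : Prop :=
  exists t : GRing.term R, forall s : seq R, GRing.eval s t = F (nth 0 s).

Lemma definable_ext P Q : (forall e, P e <-> Q e) -> definable P -> definable Q.
Proof. by move=> PQ [f hf]; exists f => s; rewrite hf. Qed.

Lemma definable_not P : definable P -> definable (fun e => ~ P e).
Proof. by move=> [f hf]; exists (ord.Not f) => s /=; rewrite hf. Qed.

Lemma definable_and P Q :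
  definable P -> definable Q -> definable (fun e => P e /\ Q e).
Proof.
by move=> [f hf] [g hg]; exists (ord.And f g) => s /=; rewrite hf hg.
Qed.

Lemma definable_imp P Q :
  definable P -> definable Q -> definable (fun e => P e -> Q e).
Proof.
by move=> [f hf] [g hg]; exists (ord.Implies f g) => s /=; rewrite hf hg.
Qed.

Lemma definable_eq F G : term_fun F -> term_fun G ->
  definable (fun e => F e = G e).
Proof.
by move=> [t ht] [u hu]; exists (ord.Equal t u) => s /=; rewrite ht hu.
Qed.

Lemma definable_lt F G : term_fun F -> term_fun G ->
  definable (fun e => F e < G e).
Proof.
by move=> [t ht] [u hu]; exists (ord.Lt t u) => s /=; rewrite ht hu.
Qed.

Lemma definable_le F G : term_fun F -> term_fun G ->
  definable (fun e => F e <= G e).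
Proof.
by move=> [t ht] [u hu]; exists (ord.Le t u) => s /=; rewrite ht hu.
Qed.

Lemma term_fun_var i : term_fun (fun e => e i).
Proof. by exists (GRing.Var R i). Qed.

Lemma term_fun_const c : term_fun (fun=> c).
Proof. by exists (GRing.Const c). Qed.

Lemma term_fun_add F G : term_fun F -> term_fun G ->
  term_fun (fun e => F e + G e).
Proof.
by move=> [t ht] [u hu]; exists (GRing.Add t u) => s /=; rewrite ht hu.
Qed.

Lemma term_fun_mul F G : term_fun F -> term_fun G ->
  term_fun (fun e => F e * G e).
Proof.
by move=> [t ht] [u hu]; exists (GRing.Mul t u) => s /=; rewrite ht hu.
Qed.

Lemma nth_upd (s : seq R) i x : nth 0 (set_nth 0 s i x) = upd (nth 0 s) i x.
Proof. by apply: funext => j; rewrite nth_set_nth. Qed.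

Lemma definable_subst P i c : definable P -> definable (fun e => P (upd e i c)).
Proof.
move=> [f hf]; exists (ord.fsubst f (i, GRing.Const c)) => s.
by rewrite ord.holds_fsubst hf nth_upd.
Qed.

Lemma definable_ex P i : definable P ->
  definable (fun e => exists x, P (upd e i x)).
Proof.
move=> [f hf]; exists (ord.Exists i f) => s /=.
by split=> [] [x hx]; exists x; move: hx; rewrite hf nth_upd.
Qed.

Lemma definable_forall P i : definable P ->
  definable (fun e => forall x, P (upd e i x)).
Proof.
move=> [f hf]; exists (ord.Forall i f) => s /=.
by split=> h x; move: (h x); rewrite hf nth_upd.
Qed.

Lemma definable_all (I : finType) (P : I -> (nat -> R) -> Prop) :
  (forall i, definable (P i)) -> definable (fun e => forall i, P i e).
Proof.
move=> dP.
have H (r : seq I) : definable (fun e => forall i, i \in r -> P i e).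
  elim: r => [|a r IH].
    by exists (ord.Bool true) => s; split.
  apply: definable_ext (definable_and (dP a) IH) => e; split.
    by move=> [h1 h2] i; rewrite inE => /orP[/eqP ->//|/h2].
  move=> h; split; first by apply: h; rewrite mem_head.
  by move=> i ir; apply: h; rewrite inE ir orbT.
apply: definable_ext (H (enum I)) => e.
by split=> h i => [|_]; apply: h; rewrite mem_enum.
Qed.

Lemma definable_tame (P : R -> Prop) : definable (fun e => P (e 0%N)) -> tame P.
Proof. by move=> [f hf]; apply: tame_ext (tame_holds f) => x; rewrite hf. Qed.

Let blk e B N (z : nat -> R) : nat -> R :=
  fun j => if (B <= j < B + N)%N then z j else e j.

Lemma definable_ex_blk P B N : definable P ->
  definable (fun e => exists z, P (blk e B N z)).
Proof.
move=> dP; elim: N => [|N IH].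
  apply: definable_ext dP => e.
  have E z : blk e B 0 z = e.
    by apply: funext => j; rewrite /blk addn0; case: (ltnP j B); rewrite ?andbF.
  by split=> [h|[z]]; first exists e; rewrite E.
apply: definable_ext (definable_ex (B + N)%N IH) => e.
have E x z : blk (upd e (B + N)%N x) B N z =
    blk e B N.+1 (upd z (B + N)%N x).
  apply: funext => j; rewrite /blk /upd addnS ltnS.
  by case: (ltngtP j (B + N)%N) => //; rewrite ?andbF ?andbT// => ->; rewrite leq_addr.
split=> [[x [z h]]|[z h]].
  by exists (upd z (B + N)%N x); rewrite -E.
exists (z (B + N)%N), z; rewrite E.
suff -> : upd z (B + N)%N (z (B + N)%N) = z by [].
by apply: funext => j; rewrite /upd; case: eqP => [->|].
Qed.

Lemma definable_ex_block (I : finType) (P : (I -> R) -> (nat -> R) -> Prop) B :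
  (forall x e e', (forall j, (j < B)%N -> e j = e' j) -> P x e -> P x e') ->
  definable (fun e => P (fun i => e (B + enum_rank i)%N) e) ->
  definable (fun e => exists x, P x e).
Proof.
move=> locP /(definable_ex_blk B #|I|); apply: definable_ext => e.
have E z (i : I) : blk e B #|I| z (B + enum_rank i)%N = z (B + enum_rank i)%N.
  by rewrite /blk leq_addr ltn_add2l ltn_ord.
have Ee z j : (j < B)%N -> blk e B #|I| z j = e j.
  by move=> jB; rewrite /blk leqNgt jB.
split=> [[z]|[x h]].
  rewrite (_ : (fun _ => _) = fun i => z (B + enum_rank i)%N); last first.
    by apply: funext => i; rewrite E.
  by move=> /(locP _ _ _ (Ee z)) h; eexists; exact: h.
exists (fun j => nth 0 [seq x i | i <- enum I] (j - B)).
rewrite (_ : (fun _ => _) = x).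
  by apply: locP h => j jB; rewrite Ee.
apply: funext => i; rewrite E addKn (nth_map i) ?nth_enum_rank//.
by rewrite -cardE ltn_ord.
Qed.

Section Poly.
Variable I : finType.
Implicit Types (A : set (I -> R)) (f g h : (I -> R) -> R) (r : I -> nat).

Inductive polyfun : ((I -> R) -> R) -> Prop :=
| polyfun_const c : polyfun (fun=> c)
| polyfun_coord i : polyfun (fun x => x i)
| polyfun_add f g : polyfun f -> polyfun g -> polyfun (fun x => f x + g x)
| polyfun_mul f g : polyfun f -> polyfun g -> polyfun (fun x => f x * g x).

Lemma polyfun_sub f g : polyfun f -> polyfun g -> polyfun (fun x => f x - g x).
Proof.
move=> pf pg.
rewrite (_ : (fun _ => _) = fun x => f x + (-1) * g x); last first.
  by apply: funext => x; rewrite mulN1r.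
by apply: polyfun_add => //; apply: polyfun_mul => //; apply: polyfun_const.
Qed.

Lemma polyfun_sum (J : Type) (s : seq J) (F : J -> (I -> R) -> R) :
  (forall j, polyfun (F j)) -> polyfun (fun x => \sum_(j <- s) F j x).
Proof.
move=> pF; elim: s => [|j s IH].
  under eq_fun do rewrite big_nil; exact: polyfun_const.
by under eq_fun do rewrite big_cons; exact: polyfun_add.
Qed.

Lemma term_fun_poly f r : polyfun f -> term_fun (fun e => f (fun i => e (r i))).
Proof.
elim=> [c|i|{}f g _ IHf _ IHg|{}f g _ IHf _ IHg].
- exact: term_fun_const.
- exact: term_fun_var.
- exact: term_fun_add.
- exact: term_fun_mul.
Qed.

Let T : topologicalType := prod_topology (fun _ : I => R).

Lemma polyfun_continuous f : polyfun f -> continuous (f : T -> R).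
Proof.
elim=> [c|i|{}f g _ IHf _ IHg|{}f g _ IHf _ IHg].
- exact: cst_continuous.
- exact: (@proj_continuous I (fun=> R) i).
- by move=> x; exact: (@cvgD R R T (nbhs x) _ f g (f x) (g x) (IHf x) (IHg x)).
- by move=> x; exact: (@cvgM R T (nbhs x) _ f g (f x) (g x) (IHf x) (IHg x)).
Qed.

(* Requiring definability for every choice [r] of names of the coordinates
   replaces renaming of the variables of formulas. *)
Definition definable_set A : Prop :=
  forall r, definable (fun e => A (fun i => e (r i))).

Let fresh r : exists B, forall i, (r i < B)%N.
Proof.
exists (\max_i r i).+1 => i; rewrite ltnS.
exact: (@leq_bigmax _ r i).
Qed.

Definition fiber_argmin f h A : set (I -> R) :=
  [set x | A x /\ forall y, A y -> f y = f x -> h x <= h y].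

Lemma definable_fiber_argmin f h A : polyfun f -> polyfun h ->
  definable_set A -> definable_set (fiber_argmin f h A).
Proof.
move=> pf ph dA r; apply: definable_and; first exact: dA.
have [B rB] := fresh r.
pose P y e := A y /\ (f y = f (fun i => e (r i)) /\ h y < h (fun i => e (r i))).
apply: (@definable_ext (fun e => ~ exists y, P y e)).
  move=> e; split=> [nP y Ay fy|hP [y [Ay [fy]]]].
    by rewrite leNgt; apply/negP => hy; apply: nP; exists y.
  by apply/negP; rewrite -leNgt; apply: hP.
apply: definable_not; apply: (@definable_ex_block _ _ B).
  move=> x e e' ee'; rewrite /P.
  suff -> : (fun i => e (r i)) = (fun i => e' (r i)) by [].
  by apply: funext => i; apply: ee'.
rewrite /P; apply: definable_and; first exact: (dA (fun i => B + enum_rank i)%N).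
apply: definable_and.
  apply: definable_eq; last exact: term_fun_poly.
  exact: (@term_fun_poly f (fun i => B + enum_rank i)%N).
apply: definable_lt; last exact: term_fun_poly.
exact: (@term_fun_poly h (fun i => B + enum_rank i)%N).
Qed.

Lemma tame_levels f A : polyfun f -> definable_set A ->
  tame (fun t => exists x, A x /\ f x = t).
Proof.
move=> pf dA; apply: definable_tame.
apply: (@definable_ex_block _ (fun x e => A x /\ f x = e 0%N) 1).
  by move=> x e e' ee'; rewrite ee'.
apply: definable_and; first exact: (dA (fun i => 1 + enum_rank i)%N).
apply: definable_eq; last exact: term_fun_var.
exact: (@term_fun_poly f (fun i => 1 + enum_rank i)%N).
Qed.

Definition level_lt f h A (s t : R) : Prop :=
  exists x, exists y, [/\ A x, A y, f x = s, f y = t & h x < h y].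

Lemma definable_level_lt f h A (a b : nat) : polyfun f -> polyfun h ->
  definable_set A -> definable (fun e => level_lt f h A (e a) (e b)).
Proof.
move=> pf ph dA; pose B := (maxn a b).+1.
have aB : (a < B)%N by rewrite ltnS leq_maxl.
have bB : (b < B)%N by rewrite ltnS leq_maxr.
pose B' := (B + #|I|)%N.
have BB' j : (j < B)%N -> (j < B')%N by move=> jB; rewrite /B' ltn_addr.
apply: (@definable_ex_block _ (fun x e =>
  exists y, [/\ A x, A y, f x = e a, f y = e b & h x < h y]) B).
  by move=> x e e' ee' [y]; rewrite !ee'// => H; exists y.
pose r (i : I) := (B + enum_rank i)%N.
have rB' i : (r i < B')%N by rewrite /r /B' ltn_add2l ltn_ord.
apply: (@definable_ex_block _ (fun y e =>
  [/\ A (fun i => e (r i)), A y, f (fun i => e (r i)) = e a, f y = e b &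
      h (fun i => e (r i)) < h y]) B').
  move=> y e e' ee'; rewrite -!ee' ?BB'//.
  suff -> : (fun i => e (r i)) = (fun i => e' (r i)) by [].
  by apply: funext => i; apply: ee'.
pose q (i : I) := (B' + enum_rank i)%N.
apply: (@definable_ext (fun e => A (fun i => e (r i)) /\ (A (fun i => e (q i)) /\
  (f (fun i => e (r i)) = e a /\ (f (fun i => e (q i)) = e b /\
   h (fun i => e (r i)) < h (fun i => e (q i))))))).
  by move=> e; split=> [[? [? [? []]]]|[]].
apply: definable_and; first exact: dA.
apply: definable_and; first exact: dA.
apply: definable_and.
  by apply: definable_eq; [exact: term_fun_poly|exact: term_fun_var].
apply: definable_and.
  by apply: definable_eq; [exact: term_fun_poly|exact: term_fun_var].
by apply: definable_lt; exact: term_fun_poly.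
Qed.

Lemma definable_box b (Q : (I -> R) -> R) : polyfun Q ->
  definable_set [set x | (forall i, - b <= x i <= b) /\ Q x = 0].
Proof.
move=> pQ r; apply: definable_and; last first.
  by apply: definable_eq; [exact: term_fun_poly|exact: term_fun_const].
apply: definable_all => i.
apply: (@definable_ext (fun e => - b <= e (r i) /\ e (r i) <= b)).
  by move=> e; split=> /andP.
apply: definable_and; apply: definable_le; first exact: term_fun_const.
- exact: term_fun_var.
- exact: term_fun_var.
- exact: term_fun_const.
Qed.

Lemma compact_box b (Q : (I -> R) -> R) : polyfun Q ->
  compact ([set x | (forall i, - b <= x i <= b) /\ Q x = 0]
           : set (T)).
Proof.
move=> pQ.
have -> : [set x | (forall i, - b <= x i <= b) /\ Q x = 0] =
  [set x : T | forall i, [set` `[- b, b]] (x i)]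
  `&` (Q : T -> R) @^-1` [set 0].
  by apply/seteqP; split=> x /= [h ->]; split=> // i; have := h i; rewrite in_itv.
apply: compact_closedI.
  by apply: (@tychonoff I (fun=> R) (fun=> [set` `[- b, b]])) => i; exact: segment_compact.
apply: closed_comp; last exact: closed_eq.
by move=> x _; exact: polyfun_continuous.
Qed.

Lemma fiber_argmin_nonempty f (hs : seq ((I -> R) -> R)) A t : polyfun f ->
  (forall i, (i < size hs)%N -> polyfun (nth f hs i)) ->
  compact (A : set (T)) ->
  (exists x, A x /\ f x = t) ->
  exists x, foldl (fun B h => fiber_argmin f h B) A hs x /\ f x = t.
Proof.
move=> pf.
move=> phs cA exA.
have : compact ([set x | A x /\ f x = t] : set T).
  have -> : [set x | A x /\ f x = t] = (A : set T) `&` (f : T -> R) @^-1` [set t].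
    by apply/seteqP; split.
  apply: compact_closedI => //; apply: closed_comp; last exact: closed_eq.
  by move=> x _; exact: polyfun_continuous.
move: {cA} exA; elim: hs A phs => [|h hs IH] A phs exA cA //=.
have ph : polyfun h by exact: (phs 0%N).
have cf : {within ([set x | A x /\ f x = t] : set T), continuous (h : T -> R)}.
  by apply: continuous_subspaceT; exact: polyfun_continuous.
have [c] := @compact_EVT_min T R h [set x | A x /\ f x = t] exA cA cf.
rewrite inE => -[Ac fc] hc.
apply: IH => [i ihs||].
- exact: (phs i.+1).
- exists c; split=> //; split=> // y Ay fy; apply: hc.
  by rewrite inE; split=> //; rewrite fy.
- have -> : [set x | fiber_argmin f h A x /\ f x = t] =
      ([set x | A x /\ f x = t] : set T) `&` (h : T -> R) @^-1` [set u | u <= h c].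
    apply/seteqP; split=> x.
      by move=> [[Ax hx] fx]; split=> //; apply: hx => //; rewrite fx.
    move=> [[Ax fx] /= hx]; split=> //; split=> // y Ay fy.
    by apply: le_trans hx _; apply: hc; rewrite inE; split=> //; rewrite fy.
  apply: compact_closedI => //; apply: closed_comp; last exact: closed_le.
  by move=> x _; exact: polyfun_continuous.
Qed.

Lemma foldl_fiber_argmin_sub f hs A x :
  foldl (fun B h => fiber_argmin f h B) A hs x -> A x.
Proof. by elim: hs A => [|h hs IH] A //= /IH[]. Qed.

Lemma definable_foldl_fiber_argmin f hs A : polyfun f ->
  (forall i, (i < size hs)%N -> polyfun (nth f hs i)) ->
  definable_set A ->
  definable_set (foldl (fun B h => fiber_argmin f h B) A hs).
Proof.
move=> pf; elim: hs A => [|h hs IH] A phs dA //=.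
apply: IH => [i|]; first exact: (phs i.+1).
by apply: definable_fiber_argmin => //; exact: (phs 0%N).
Qed.
End Poly.
End Definable.

(** * Monotonicity of definable functions *)

Section Monotone.
Variable R : realType.
Implicit Types (g : R -> R) (t u v s : R).

Lemma local_trans_itv (T : R -> R -> Prop) a b :
  (forall x y z, T x y -> T y z -> T x z) ->
  (forall t, a < t < b -> exists2 v, t < v & forall s, t < s < v -> T t s) ->
  (forall t, a < t < b -> exists2 v, v < t & forall s, v < s < t -> T s t) ->
  forall x y, a < x -> x < y -> y < b -> T x y.
Proof.
move=> trT Tr Tl x y ax xy yb.
pose S := [set s | x < s <= y /\ forall w, x < w <= s -> T x w].
have [v xv hv] := Tr x (introT andP (conj ax (lt_trans xy yb))).
pose s0 := Num.min y ((x + v) / 2).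
have S0 : S s0.
  have xs0 : x < s0 by rewrite lt_min xy; lra.
  split; first by rewrite xs0 ge_min lexx.
  move=> w /andP[xw ws0]; apply: hv; rewrite xw /=.
  by move: ws0; rewrite le_min => /andP[_ ws]; lra.
have ubS : ubound S y by move=> s [/andP[]].
have hsS : has_sup S by split; [exists s0|exists y].
pose c := sup S.
have cy : c <= y by apply: ge_sup => //; exists s0.
have s0c : s0 <= c by apply: ub_le_sup => //; exists y.
have xc : x < c by apply: lt_le_trans s0c; case: S0 => /andP[].
have Tlt w : x < w < c -> T x w.
  move=> /andP[xw wc].
  have cw0 : 0 < c - w by rewrite subr_gt0.
  have [s Ss ws] := sup_adherent cw0 hsS.
  case: Ss => _; apply; rewrite xw /=.
  by move: ws; rewrite -/c; lra.
have acb : a < c < b by rewrite (lt_trans ax) // (le_lt_trans cy).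
have [l lc hl] := Tl c acb.
have Txc : T x c.
  pose w := (Num.max l x + c) / 2.
  have lxc : Num.max l x < c by rewrite gt_max lc.
  have lm : l <= Num.max l x by rewrite le_max lexx.
  have xm : x <= Num.max l x by rewrite le_max lexx orbT.
  by apply: (trT _ w); [apply: Tlt|apply: hl]; rewrite /w; lra.
suff <- : c = y by [].
apply/eqP; rewrite eq_le cy /= leNgt; apply/negP => cy'.
have [r cr hr] := Tr c acb.
pose w := Num.min y ((c + r) / 2).
have cw : c < w by rewrite lt_min cy'; lra.
suff : S w by move=> Sw; have := ub_le_sup (ex_intro _ y ubS) Sw; rewrite leNgt cw.
split; first by rewrite (lt_trans xc cw) ge_min lexx.
move=> z /andP[xz zw].
case: (ltgtP z c) => [zc|cz|->//]; first by apply: Tlt; rewrite xz.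
apply: trT Txc _; apply: hr; rewrite cz /=.
by move: zw; rewrite le_min => /andP[_]; lra.
Qed.

(* Points that are strict minima on a ball of radius 1/(k+1) lie in distinct
   grid cells of that size, so strict local minima are countable. *)
Lemma no_local_min_itv g a b : a < b ->
  (forall t, a < t < b -> exists2 v, t < v & forall s, t < s < v -> g t < g s) ->
  (forall t, a < t < b -> exists2 v, v < t & forall s, v < s < t -> g t < g s) ->
  False.
Proof.
move=> ab hr hl.
have ex t : exists k : nat, a < t < b ->
    forall s, `|s - t| < k.+1%:R^-1 -> s != t -> g t < g s.
  case: (boolP (a < t < b)) => [atb|_]; last by exists 0%N.
  have [v tv hv] := hr t atb; have [w wt hw] := hl t atb.
  pose d := Num.min (v - t) (t - w).
  have d0 : 0 < d by rewrite lt_min !subr_gt0 tv.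
  have [k kd] : exists k : nat, k.+1%:R^-1 < d.
    have := near_infty_natSinv_lt (PosNum d0) => -[k _ /(_ k)].
    by move=> /(_ (leqnn _)) h; exists k.
  exists k => _ s sk st.
  have : `|s - t| < d by apply: lt_trans kd.
  rewrite /d lt_min !ltr_norml => /andP[/andP[h1 h2] /andP[h3 h4]].
  case: (ltgtP s t) st => // st _; [apply: hw|apply: hv]; lra.
pose K t := projT1 (cid (ex t)).
have KP t : a < t < b -> forall s, `|s - t| < (K t).+1%:R^-1 -> s != t ->
    g t < g s by rewrite /K; case: cid.
pose code t : nat * int := (K t, Num.floor (t * (K t).+1%:R)).
have code_inj : {in `]a, b[ &, injective code}.
  move=> s t; rewrite !in_itv /= => sab tab [Kst].
  rewrite -Kst => fst; apply/eqP; apply: contraT => st.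
  have K0 : 0 < (K s).+1%:R :> R by rewrite ltr0n.
  have d : `|s - t| < (K s).+1%:R^-1.
    rewrite -[ltRHS]div1r ltr_pdivlMr// -[X in _ * X < _]gtr0_norm// -normrM.
    rewrite mulrBl.
    have := floor_itv (s * (K s).+1%:R); have := floor_itv (t * (K s).+1%:R).
    rewrite fst ltr_norml; set m := _%:~R.
    rewrite intrD -/m; lra.
  have h1 := KP s sab t; have h2 := KP t tab s.
  have := lt_trans (h1 _ _) (h2 _ _); rewrite ltxx; apply.
  - by rewrite distrC.
  - by rewrite eq_sym.
  - by rewrite -Kst.
  - by [].
have : countable (`]a, b[ : set R).
  apply/countable_injP.
  exists (fun t => pickle (code t)) => s t; rewrite !inE => hs ht.
  by move=> /(pcan_inj pickleK) /code_inj; apply.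
move=> /countable_lebesgue_measure0.
rewrite lebesgue_measure_itv /= lte_fin ab -EFinB => -[/eqP].
by rewrite subr_eq0 gt_eqF.
Qed.

Definition monotone_on g a b :=
  [\/ forall s t, a < s -> s < t -> t < b -> g s < g t,
      forall s t, a < s -> s < t -> t < b -> g s = g t |
      forall s t, a < s -> s < t -> t < b -> g t < g s].

Lemma monotone_near_right (L : R -> R -> Prop) g a b : a < b ->
  (forall i j : nat, definable (fun e => L (e i) (e j))) ->
  (forall s t, a < s < b -> a < t < b -> (L s t <-> g s < g t)) ->
  exists2 c, a < c <= b & monotone_on g a c.
Proof.
move=> ab dL Lg.
have tameLr t : tame (L t).
  apply: (@definable_tame R (L t)).
  exact: definable_ext (definable_subst 1 t (dL 1%N 0%N)).
have tameLl t : tame (L ^~ t).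
  apply: (@definable_tame R (L ^~ t)).
  exact: definable_ext (definable_subst 1 t (dL 0%N 1%N)).
have tameR (M : R -> R -> Prop) :
    (forall i j : nat, definable (fun e => M (e i) (e j))) ->
    tame (fun t => exists v, t < v /\ forall s, t < s < v -> M t s).
  move=> dM; apply: definable_tame.
  apply: (@definable_ext R (fun e => exists v, upd e 1 v 0%N < upd e 1 v 1%N /\
     forall s, upd (upd e 1 v) 2 s 0%N < upd (upd e 1 v) 2 s 2 /\
     upd (upd e 1 v) 2 s 2 < upd (upd e 1 v) 2 s 1%N ->
     M (upd (upd e 1 v) 2 s 0%N) (upd (upd e 1 v) 2 s 2))).
    move=> e; rewrite /upd /=.
    by split=> -[v [tv hv]]; exists v; split=> // s hs; apply: hv; move/andP: hs.
  apply: (definable_ex (P := fun e => e 0%N < e 1%N /\ forall s,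
     upd e 2 s 0%N < upd e 2 s 2 /\ upd e 2 s 2 < upd e 2 s 1%N ->
     M (upd e 2 s 0%N) (upd e 2 s 2))).
  apply: definable_and; first by apply: definable_lt; exact: term_fun_var.
  apply: (definable_forall (P := fun e => e 0%N < e 2 /\ e 2 < e 1%N ->
     M (e 0%N) (e 2))).
  apply: definable_imp => //.
  by apply: definable_and; apply: definable_lt; exact: term_fun_var.
have tameL (M : R -> R -> Prop) :
    (forall i j : nat, definable (fun e => M (e i) (e j))) ->
    tame (fun t => exists v, v < t /\ forall s, v < s < t -> M t s).
  move=> dM; apply: definable_tame.
  apply: (@definable_ext R (fun e => exists v, upd e 1 v 1%N < upd e 1 v 0%N /\
     forall s, upd (upd e 1 v) 2 s 1%N < upd (upd e 1 v) 2 s 2 /\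
     upd (upd e 1 v) 2 s 2 < upd (upd e 1 v) 2 s 0%N ->
     M (upd (upd e 1 v) 2 s 0%N) (upd (upd e 1 v) 2 s 2))).
    move=> e; rewrite /upd /=.
    by split=> -[v [tv hv]]; exists v; split=> // s hs; apply: hv; move/andP: hs.
  apply: (definable_ex (P := fun e => e 1%N < e 0%N /\ forall s,
     upd e 2 s 1%N < upd e 2 s 2 /\ upd e 2 s 2 < upd e 2 s 0%N ->
     M (upd e 2 s 0%N) (upd e 2 s 2))).
  apply: definable_and; first by apply: definable_lt; exact: term_fun_var.
  apply: (definable_forall (P := fun e => e 1%N < e 2 /\ e 2 < e 0%N ->
     M (e 0%N) (e 2))).
  apply: definable_imp => //.
  by apply: definable_and; apply: definable_lt; exact: term_fun_var.
have [c1 ac1 h1] := tame_right a (tameR L dL).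
have [c2 ac2 h2] := tame_right a (tameR (fun s t => L t s) (fun i j => dL j i)).
have [c3 ac3 h3] := tame_right a (tameL L dL).
have [c4 ac4 h4] := tame_right a (tameL (fun s t => L t s) (fun i j => dL j i)).
pose c := Num.min (Num.min b (Num.min c1 c2)) (Num.min c3 c4).
have ac : a < c by rewrite !lt_min ab ac1 ac2 ac3 ac4.
have cP t : t < c -> [/\ t < b, t < c1, t < c2 & t < c3 /\ t < c4].
  by rewrite !lt_min -!andbA => /and5P[].
have cb t : a < t < c -> a < t < b by move=> /andP[-> /cP[]].
exists c; first by rewrite ac !ge_min lexx.
pose gt_r t := exists2 v, t < v & forall s, t < s < v -> g t < g s.
pose lt_r t := exists2 v, t < v & forall s, t < s < v -> g s < g t.
pose eq_r t := exists2 v, t < v & forall s, t < s < v -> g t = g s.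
pose gt_l t := exists2 v, v < t & forall s, v < s < t -> g t < g s.
pose lt_l t := exists2 v, v < t & forall s, v < s < t -> g s < g t.
pose eq_l t := exists2 v, v < t & forall s, v < s < t -> g s = g t.
have right_cases : [\/ forall t, a < t < c -> gt_r t,
    forall t, a < t < c -> lt_r t | forall t, a < t < c -> eq_r t].
  have shrink t (M : R -> R -> Prop) : a < t < c ->
      (exists v, t < v /\ forall s, t < s < v -> M t s) ->
      exists2 v, t < v & forall s, t < s < v -> M t s /\ a < s < b.
    move=> /andP[at_ tc] [v [tv hv]]; exists (Num.min v c); first by rewrite lt_min tv.
    move=> s; rewrite lt_min => /and3P[ts sv sc]; split; first by apply: hv; rewrite ts.
    by apply: cb; rewrite sc (lt_trans at_).
  case: h1 => h1.
    apply: Or31 => t tac; have [|v tv hv] := shrink t L tac.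
      by apply: h1; case/andP: tac => -> /cP[].
    by exists v => // s /hv[+ sab] => /Lg; apply=> //; apply: cb.
  case: h2 => h2.
    apply: Or32 => t tac; have [|v tv hv] := shrink t (fun s t => L t s) tac.
      by apply: h2; case/andP: tac => -> /cP[].
    by exists v => // s /hv[+ sab] => /Lg; apply=> //; apply: cb.
  apply: Or33 => t tac.
  have ac1' : a < t < c1 by case/andP: tac => -> /cP[].
  have ac2' : a < t < c2 by case/andP: tac => -> /cP[].
  have [v1 tv1 [hv1|hv1]] := tame_right t (tameLr t); first by case: (h1 t ac1'); exists v1.
  have [v2 tv2 [hv2|hv2]] := tame_right t (tameLl t); first by case: (h2 t ac2'); exists v2.
  have [|v tv hv] := shrink t (fun t s => ~ L t s /\ ~ L s t) tac.
    exists (Num.min v1 v2); rewrite lt_min tv1 tv2; split=> // s.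
    by rewrite lt_min => /and3P[ts s1 s2]; split; [apply: hv1|apply: hv2]; rewrite ts.
  exists v => // s /hv[[n1 n2] sab]; case: (ltgtP (g t) (g s)) => // gts.
    by case: n1; apply/Lg => //; apply: cb.
  by case: n2; apply/Lg => //; apply: cb.
have left_cases : [\/ forall t, a < t < c -> gt_l t,
    forall t, a < t < c -> lt_l t | forall t, a < t < c -> eq_l t].
  have shrink t (M : R -> R -> Prop) : a < t < c ->
      (exists v, v < t /\ forall s, v < s < t -> M t s) ->
      exists2 v, v < t & forall s, v < s < t -> M t s /\ a < s < b.
    move=> /andP[at_ tc] [v [tv hv]]; exists (Num.max v a); first by rewrite gt_max tv.
    move=> s; rewrite gt_max -andbA => /and3P[vs as_ st]; split; first by apply: hv; rewrite vs.
    by apply: cb; rewrite as_ (lt_trans st).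
  case: h3 => h3.
    apply: Or31 => t tac; have [|v tv hv] := shrink t L tac.
      by apply: h3; case/andP: tac => -> /cP[_ _ _ []].
    by exists v => // s /hv[+ sab] => /Lg; apply=> //; apply: cb.
  case: h4 => h4.
    apply: Or32 => t tac; have [|v tv hv] := shrink t (fun s t => L t s) tac.
      by apply: h4; case/andP: tac => -> /cP[_ _ _ []].
    by exists v => // s /hv[+ sab] => /Lg; apply=> //; apply: cb.
  apply: Or33 => t tac.
  have ac1' : a < t < c3 by case/andP: tac => -> /cP[_ _ _ []].
  have ac2' : a < t < c4 by case/andP: tac => -> /cP[_ _ _ []].
  have [v1 tv1 [hv1|hv1]] := tame_left t (tameLr t); first by case: (h3 t ac1'); exists v1.
  have [v2 tv2 [hv2|hv2]] := tame_left t (tameLl t); first by case: (h4 t ac2'); exists v2.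
  have [|v tv hv] := shrink t (fun t s => ~ L t s /\ ~ L s t) tac.
    exists (Num.max v1 v2); rewrite gt_max tv1 tv2; split=> // s.
    by rewrite gt_max -andbA => /and3P[ts s1 s2]; split; [apply: hv1|apply: hv2]; rewrite ?ts ?s1.
  exists v => // s /hv[[n1 n2] sab]; case: (ltgtP (g s) (g t)) => // gts.
    by case: n2; apply/Lg => //; apply: cb.
  by case: n1; apply/Lg => //; apply: cb.
pose m := (a + c) / 2.
have mac : a < m < c by rewrite /m; lra.
have eqr_false : (forall t, a < t < c -> eq_r t) ->
    (forall t, a < t < c -> gt_l t \/ lt_l t) -> False.
  move=> er gl; have [v mv hv] := er m mac.
  pose p := (m + Num.min v c) / 2.
  have mm : m < Num.min v c by rewrite lt_min mv; lra.
  have mv' : Num.min v c <= v by rewrite ge_min lexx.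
  have mc' : Num.min v c <= c by rewrite ge_min lexx orbT.
  have pac : a < p < c by rewrite /p; lra.
  have gp : g m = g p by apply: hv; rewrite /p; lra.
  have [w wp hw] : exists2 w, w < p & forall s, w < s < p -> g s <> g p.
    by case: (gl p pac) => -[w wp hw]; exists w => // s /hw + e;
      rewrite e ltxx.
  have wm : Num.max w m < p by rewrite gt_max wp /p; lra.
  have h1' : w <= Num.max w m by rewrite le_max lexx.
  have h2' : m <= Num.max w m by rewrite le_max lexx orbT.
  pose q := (p + Num.max w m) / 2.
  apply: (hw q); first by rewrite /q; lra.
  by rewrite -gp; apply/esym/hv; move: wm; rewrite /q /p; lra.
have eql_false : (forall t, a < t < c -> eq_l t) ->
    (forall t, a < t < c -> gt_r t \/ lt_r t) -> False.
  move=> er gl; have [v mv hv] := er m mac.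
  pose p := (m + Num.max v a) / 2.
  have mm : Num.max v a < m by rewrite gt_max mv; lra.
  have mv' : v <= Num.max v a by rewrite le_max lexx.
  have mc' : a <= Num.max v a by rewrite le_max lexx orbT.
  have pac : a < p < c by rewrite /p; lra.
  have gp : g p = g m by apply: hv; rewrite /p; lra.
  have [w wp hw] : exists2 w, p < w & forall s, p < s < w -> g s <> g p.
    by case: (gl p pac) => -[w wp hw]; exists w => // s /hw + e;
      rewrite e ltxx.
  have wm : p < Num.min w m by rewrite lt_min wp /p; lra.
  have h1' : Num.min w m <= w by rewrite ge_min lexx.
  have h2' : Num.min w m <= m by rewrite ge_min lexx orbT.
  pose q := (p + Num.min w m) / 2.
  apply: (hw q); first by rewrite /q; lra.
  by rewrite gp; apply: hv; move: wm; rewrite /q /p; lra.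
case: right_cases => hr; case: left_cases => hl.
- by case: (no_local_min_itv ac hr hl).
- apply: Or31; apply: (local_trans_itv (T := fun s t => g s < g t)) => //.
  by move=> x y z; exact: lt_trans.
- by case: (eql_false hl) => t /hr; left.
- apply: Or33; apply: (local_trans_itv (T := fun s t => g t < g s)) => //.
  by move=> x y z h h'; exact: lt_trans h' h.
- case: (@no_local_min_itv (fun t => - g t) a c ac) => t /=.
    by move=> /hr[v tv hv]; exists v => // s /hv; rewrite ltrN2.
  by move=> /hl[v tv hv]; exists v => // s /hv; rewrite ltrN2.
- by case: (eql_false hl) => t /hr; right.
- by case: (eqr_false hr) => t /hl; left.
- by case: (eqr_false hr) => t /hl; right.
- apply: Or32; apply: (local_trans_itv (T := fun s t => g s = g t)) => //.
  by move=> x y z -> ->.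
Qed.
End Monotone.

(** * Finite length of descent sequences *)

Section Length.
Variables (R : realType) (I : finType).
Implicit Types (x y z : I -> R) (g : R -> R).

Definition dist1 x y : R := \sum_i `|y i - x i|.

Lemma dist1_ge0 x y : 0 <= dist1 x y.
Proof. by apply: sumr_ge0 => i _; exact: normr_ge0. Qed.

Lemma dist1_box b x y : (forall i, - b <= x i <= b) ->
  (forall i, - b <= y i <= b) -> dist1 x y <= \sum_(i : I) 2 * b.
Proof.
move=> hx hy; apply: ler_sum => i _; rewrite ler_norml.
by have := hx i; have := hy i; lra.
Qed.

Lemma monotone_on_sub g a c c' : c' <= c -> monotone_on g a c ->
  monotone_on g a c'.
Proof.
by move=> cc [] h; [apply: Or31|apply: Or32|apply: Or33] => s t as_ st tc;
  apply: h => //; exact: lt_le_trans cc.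
Qed.

Lemma monotone_on_dist g a c s t u : monotone_on g a c ->
  a < s -> s <= t -> t <= u -> u < c -> `|g u - g s| = `|g t - g s| + `|g u - g t|.
Proof.
move=> mg as_; rewrite le_eqVlt => /predU1P[<-|st].
  by rewrite subrr normr0 add0r.
rewrite le_eqVlt => /predU1P[<-|tu] uc.
  by rewrite subrr normr0 addr0.
have tc := lt_trans tu uc; have at_ := lt_trans as_ st.
case: mg => h; have h1 := h _ _ as_ st tc; have h2 := h _ _ at_ tu uc.
- by rewrite !gtr0_norm; lra.
- by rewrite -h2 -h1 subrr normr0 addr0.
- by rewrite !ltr0_norm; lra.
Qed.

Lemma monotone_on_dist1 (x : R -> I -> R) a c s t u :
  (forall i, monotone_on (fun t => x t i) a c) ->
  a < s -> s <= t -> t <= u -> u < c ->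
  dist1 (x s) (x u) = dist1 (x s) (x t) + dist1 (x t) (x u).
Proof.
move=> mx as_ st tu uc; rewrite -big_split; apply: eq_bigr => i _.
exact: (monotone_on_dist (mx i)).
Qed.

(* On a subdivision of [s, t] into p ^ 2 pieces of length h, a piece on which
   [x] moves by at most 1 / p is controlled by the hypothesis, and one on which
   [x] moves by more satisfies h <= h * p * dist1: continuity is not needed. *)
Lemma monotone_length_bound (x : R -> I -> R) (m : R -> R) L a c s t :
  (forall i, monotone_on (fun t => x t i) a c) -> 0 <= L ->
  (forall u, 0 <= m u) ->
  (forall u v, a < u -> u < v -> v < c -> m u <= m v) ->
  (forall u v, a < u -> u < v -> v < c ->
    v - u <= (m u + L * dist1 (x u) (x v)) * dist1 (x u) (x v)) ->
  a < s -> s < t -> t < c -> t - s <= m t * dist1 (x s) (x t).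
Proof.
move=> mx L0 m0 mm ineq as_ st tc.
set D := dist1 (x s) (x t).
have key q : t - s <= (m t + (L + (t - s)) / q.+1%:R) * D.
  pose p : R := q.+1%:R; have p0 : 0 < p by rewrite ltr0n.
  pose n := (q.+1 * q.+1)%N.
  pose h := (t - s) / (p * p).
  have h0 : 0 < h by rewrite divr_gt0 ?subr_gt0// mulr_gt0.
  have nh : n%:R * h = t - s.
    by rewrite /n natrM /h -/p mulrC divfK// mulf_neq0// gt_eqF.
  pose C := m t + L / p + h * p.
  have C0 : 0 <= C.
    apply: addr_ge0; last by rewrite mulr_ge0// ltW.
    by apply: addr_ge0 => //; rewrite divr_ge0// ltW.
  pose w j := s + j%:R * h.
  have step u v : s <= u -> v <= t -> v - u = h -> h <= C * dist1 (x u) (x v).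
    move=> su vt vu.
    have uv : u < v by lra.
    have := ineq u v (lt_le_trans as_ su) uv (le_lt_trans vt tc); rewrite vu.
    have d0 := dist1_ge0 (x u) (x v); set d := dist1 _ _ in d0 *.
    have mut : m u <= m t.
      by apply: mm => //; [exact: lt_le_trans su|exact: lt_le_trans vt].
    case: (lerP d p^-1) => dp h1.
      apply: le_trans h1 _; apply: ler_wpM2r => //.
      rewrite /C -addrA; apply: lerD => //.
      by apply: (le_trans (ler_wpM2l L0 dp)); rewrite lerDl mulr_ge0// ltW.
    apply: (@le_trans _ _ (h * p * d)).
      rewrite -mulrA ler_pMr// -(mulfV (lt0r_neq0 p0)).
      by rewrite ler_pM2l// ltW.
    by apply: ler_wpM2r => //; rewrite lerDr addr_ge0// divr_ge0// ltW.
  have wS j : w j.+1 = w j + h by rewrite /w mulrSr mulrDl mul1r addrA.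
  have sw j : s <= w j by rewrite /w lerDl mulr_ge0// ltW.
  have wt j : (j <= n)%N -> w j <= t.
    move=> jn; rewrite /w -lerBrDl -nh ler_pM2r// ler_nat//.
  have : forall j, (j <= n)%N -> j%:R * h <= C * dist1 (x s) (x (w j)).
    elim=> [_|j IH jn]; first by rewrite mul0r mulr_ge0// dist1_ge0.
    rewrite mulrSr mulrDl mul1r.
    rewrite (monotone_on_dist1 mx as_ (sw j) _ (le_lt_trans (wt _ jn) tc)); last first.
      by rewrite wS lerDl ltW.
    rewrite mulrDr; apply: lerD; first exact: IH (ltnW jn).
    by apply: step => //; [exact: wt|rewrite wS addrAC subrr add0r].
  move=> /(_ n (leqnn n)); rewrite nh.
  have -> : w n = t by rewrite /w nh; lra.
  rewrite -/D; suff -> : C = m t + (L + (t - s)) / p by [].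
  by rewrite /C /h; field; rewrite gt_eqF.
rewrite leNgt; apply/negP => lt1.
pose E := (L + (t - s)) * D.
have e0 : 0 < t - s - m t * D by rewrite subr_gt0.
have E0 : 0 <= E by rewrite mulr_ge0 ?dist1_ge0// addr_ge0// subr_ge0 ltW.
pose q := Num.truncn (E / (t - s - m t * D)).
have := truncnS_gt (E / (t - s - m t * D)); rewrite -/q ltr_pdivrMr// => hq.
have := key q; rewrite mulrDl.
have -> : (L + (t - s)) / q.+1%:R * D = E / q.+1%:R by rewrite /E mulrAC.
have q0 : 0 < q.+1%:R :> R by rewrite ltr0n.
by rewrite -lerBlDl ler_pdivlMr// mulrC leNgt hq.
Qed.

Lemma finite_common_bound (J : finType) (P : J -> R -> Prop) a u : a < u ->
  (forall j c c', c' <= c -> P j c -> P j c') ->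
  (forall j, exists2 c, a < c <= u & P j c) ->
  exists2 c, a < c <= u & forall j, P j c.
Proof.
move=> au Psub hP.
have H (s : seq J) : exists2 c, a < c <= u & forall j, j \in s -> P j c.
  elim: s => [|j s [c /andP[ac cu] hc]]; first by exists u; rewrite ?au ?lexx.
  have [d /andP[ad du] hd] := hP j; exists (Num.min c d).
    by rewrite lt_min ac ad ge_min cu.
  move=> i; rewrite inE => /orP[/eqP ->|/hc].
    by apply: Psub hd; rewrite ge_min lexx orbT.
  by apply: Psub; rewrite ge_min lexx.
have [c acu hc] := H (enum J); exists c => // j; apply: hc.
by rewrite mem_enum.
Qed.
End Length.

Section FiniteLength.
Variables (R : realType) (I : finType).
Implicit Types (x y : I -> R) (f h : (I -> R) -> R) (A : set (I -> R)).

Lemma foldl_fiber_argmin_eq f hs A x y h0 n : (n < size hs)%N ->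
  foldl (fun B h => fiber_argmin f h B) A hs x ->
  foldl (fun B h => fiber_argmin f h B) A hs y ->
  f x = f y -> nth h0 hs n x = nth h0 hs n y.
Proof.
elim: hs A n => [//|h hs IH] A [_|n]; last exact: IH.
move=> /= /(@foldl_fiber_argmin_sub R I f hs (fiber_argmin f h A) _) [Ax hx].
move=> /(@foldl_fiber_argmin_sub R I f hs (fiber_argmin f h A) _) [Ay hy] fxy.
by apply/eqP; rewrite eq_le hx//= hy.
Qed.

Lemma level_monotone f h A (X : R -> I -> R) a u : polyfun f -> polyfun h ->
  definable_set A -> a < u ->
  (forall t, a < t < u -> A (X t) /\ f (X t) = t) ->
  (forall x y, A x -> A y -> f x = f y -> h x = h y) ->
  exists2 c, a < c <= u & monotone_on (fun t => h (X t)) a c.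
Proof.
move=> pf ph dA au hX hA.
have dL i j := definable_level_lt i j pf ph dA.
apply: (monotone_near_right au dL) => s t sau tau.
have [As fs] := hX s sau; have [At ft] := hX t tau.
split=> [[x [y [Ax Ay fx fy]]]|hst]; last by exists (X s), (X t).
by rewrite (hA _ _ Ax As) ?fx ?fs// (hA _ _ Ay At) ?fy ?ft.
Qed.

Lemma finite_length_sequence (f G Q : (I -> R) -> R) (b K L B c : R)
    (z : nat -> I -> R) (M : set (I -> R)) :
  M = [set x | (forall i, - b <= x i <= b) /\ Q x = 0] ->
  polyfun f -> polyfun G -> polyfun Q ->
  0 <= K -> 0 <= L -> 0 <= B -> 0 < c ->
  (forall x, M x -> 0 <= G x) ->
  (forall x y, M x -> M y ->
    f y - f x <= (K * Num.sqrt (G x) + L * dist1 x y) * dist1 x y) ->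
  (forall r, M (z r)) ->
  (forall r, c * dist1 (z r) (z r.+1) ^+ 2 <= f (z r) - f (z r.+1)) ->
  (forall r, G (z r) <= B * dist1 (z r) (z r.+1) ^+ 2) ->
  exists S, forall n, \sum_(r < n) dist1 (z r) (z r.+1) <= S.
Proof.
move=> EM_ pf pG pQ K0 L0 B0 c0 G0 Hlip Mz Hdec HG.
pose s r := dist1 (z r) (z r.+1); pose t r := f (z r).
have s0 r : 0 <= s r by exact: dist1_ge0.
have tailP N T : (forall n, \sum_(r < n) s (N + r)%N <= T) ->
    exists S, forall n, \sum_(r < n) s r <= S.
  move=> hT; exists (\sum_(r < N) s r + T) => n.
  apply: (@le_trans _ _ (\sum_(r < N + n) s r)).
    rewrite addnC big_split_ord /= lerDl; exact: sumr_ge0.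
  by rewrite big_split_ord /= lerD2l; exact: hT.
have tdec r : t r.+1 <= t r.
  by rewrite -subr_ge0 (le_trans _ (Hdec r))// mulr_ge0 ?sqr_ge0// ltW.
have tmono r q : (r <= q)%N -> t q <= t r.
  by move/subnK <-; elim: (q - r)%N => [//|k IH]; rewrite addSn; apply: le_trans IH.
have boxM x : M x -> forall i, - b <= x i <= b by rewrite EM_ => -[].
pose W := \sum_(i : I) 2 * b.
have distW x y : M x -> M y -> dist1 x y <= W.
  by move=> /boxM hx /boxM hy; exact: dist1_box.
have W0 : 0 <= W by apply: le_trans (distW _ _ (Mz 0%N) (Mz 0%N)); exact: dist1_ge0.
have sqG r : Num.sqrt (G (z r)) <= Num.sqrt B * s r.
  have -> : s r = Num.sqrt (s r ^+ 2) by rewrite sqrtr_sqr ger0_norm.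
  by rewrite -sqrtrM// ler_wsqrtr.
have tlow r : t 0%N - (K * (Num.sqrt B * W) + L * W) * W <= t r.
  rewrite lerBlDr -lerBlDl; apply: le_trans (Hlip _ _ (Mz r) (Mz 0%N)) _.
  have dW := distW _ _ (Mz r) (Mz 0%N).
  have sW : s r <= W by exact: distW.
  apply: ler_pM => //; rewrite ?dist1_ge0// ?addr_ge0 ?mulr_ge0 ?dist1_ge0//.
  apply: lerD; last exact: ler_wpM2l.
  apply: ler_wpM2l => //; apply: le_trans (sqG r) _.
  by apply: ler_wpM2l => //; exact: sqrtr_ge0.
have hinf : has_inf (range t).
  split; first by exists (t 0%N), 0%N.
  by exists (t 0%N - (K * (Num.sqrt B * W) + L * W) * W) => _ [r _ <-].
pose a := inf (range t).
have at_ r : a <= t r by apply: ge_inf; [case: hinf|exists r].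
have ta e : a < e -> exists N, forall r, (N <= r)%N -> t r < e.
  move=> ae; have [_ [N _ <-] tN] : exists2 y, range t y & y < e.
    have e0 : 0 < e - a by rewrite subr_gt0.
    have [y Sy ye] := inf_adherent e0 hinf; exists y => //.
    by rewrite -/a in ye; lra.
  by exists N => r Nr; apply: le_lt_trans tN; exact: tmono.
have [[N tN]|/forallNP hne] := pselect (exists N, t N = a).
  apply: (tailP N 0) => n; apply: sumr_le0 => r _.
  have h := Hdec (N + r)%N.
  have h1 : t (N + r)%N <= a by rewrite -tN; apply: tmono; exact: leq_addr.
  have h2 := at_ (N + r).+1.
  have : c * s (N + r)%N ^+ 2 <= 0 by rewrite /s; rewrite /t in h1 h2; lra.
  by rewrite pmulr_rle0// exprn_even_le0//= => /eqP; rewrite /s => ->.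
have att r : a < t r by rewrite lt_neqAle at_ andbT; apply/eqP => /esym; exact: hne.
pose T := prod_topology (fun _ : I => R).
pose hs := G :: [seq (fun x : I -> R => x i) | i <- enum I].
have phs i : (i < size hs)%N -> polyfun (nth f hs i).
  case: i => [|i] //=; rewrite size_map ltnS => ilt.
  case: (pickP I) => [j0 _|I0]; last first.
    by move: ilt; rewrite -cardE (eq_card0 I0).
  by rewrite (nth_map j0)//; exact: polyfun_coord.
have cM : compact (M : set T) by rewrite EM_; exact: compact_box.
have dM : definable_set M by rewrite EM_; exact: definable_box.
pose A := foldl (fun B h => fiber_argmin f h B) M hs.
have dA : definable_set A by exact: definable_foldl_fiber_argmin.
have AG x : A x -> M x /\ forall y, M y -> f y = f x -> G x <= G y.
  by move=> /(@foldl_fiber_argmin_sub R I f _ (fiber_argmin f G M) _) [].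
have exA r : exists x, A x /\ f x = t r.
  by apply: fiber_argmin_nonempty => //; exists (z r).
have [u au hu] := tame_right a (tame_levels pf dA).
case: hu => hu; last first.
  have [N hN] := ta u au; case: (hu (t N)); last exact: exA.
  by rewrite att hN.
have [X hX] : {X : R -> I -> R &
    forall v, a < v < u -> A (X v) /\ f (X v) = v}.
  apply: (@choice R (I -> R) (fun v x => a < v < u -> A x /\ f x = v)) => v.
  case: (boolP (a < v < u)) => [/hu[x hx]|_]; first by exists x.
  by exists (z 0%N).
have XM v : a < v < u -> M (X v) by move=> /hX[/AG[]].
have [c1 /andP[ac1 c1u] mX] : exists2 c1, a < c1 <= u &
    forall i, monotone_on (fun v => X v i) a c1.
  apply: (@finite_common_bound R I (fun i => monotone_on (fun v => X v i) a)) => //.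
    by move=> i d d' dd'; exact: monotone_on_sub.
  move=> i; have eqA x y : A x -> A y -> f x = f y -> x i = y i.
    move=> Ax Ay fxy.
    have := @foldl_fiber_argmin_eq f hs M x y f (enum_rank i).+1.
    rewrite /= size_map -cardE ltnS => /(_ (ltn_ord _) Ax Ay fxy).
    by rewrite (nth_map i) ?nth_enum_rank// -cardE.
  exact: (level_monotone pf (polyfun_coord R i) dA au hX eqA).
have [c2 /andP[ac2 c2u] mG] : exists2 c2, a < c2 <= u &
    monotone_on (fun v => G (X v)) a c2.
  apply: (level_monotone pf pG dA au hX) => x y Ax Ay fxy.
  exact: (@foldl_fiber_argmin_eq f hs M x y f 0%N).
have GXz r : t r < u -> G (X (t r)) <= G (z r).
  move=> tu; have /hX[/AG[_ hG] fX] : a < t r < u by rewrite att.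
  by apply: hG.
have tsq r : c * s r ^+ 2 <= t r - a.
  by apply: le_trans (Hdec r) _; rewrite lerB// at_.
have Gincr v w : a < v -> v < w -> w < c2 -> G (X v) <= G (X w).
  case: mG => h av vw wc; [by rewrite ltW// h|by rewrite (h v w)|].
  exfalso.
  have GvGw := h _ _ av vw wc; set e := G (X v) in GvGw.
  have e0 : 0 < e.
    apply: le_lt_trans GvGw; apply: G0; apply: XM.
    by rewrite (lt_trans av)//= (lt_le_trans wc).
  pose d := a + c * (e / 2 / (B + 1)).
  have B1 : 0 < B + 1 by rewrite ltr_wpDl.
  have ad : a < d by rewrite ltrDl mulr_gt0// !divr_gt0.
  have : a < Num.min v d by rewrite lt_min av.
  move=> /ta[N /(_ N (leqnn _))]; rewrite lt_min => /andP[tv td].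
  have vc : v < c2 := lt_trans vw wc.
  have := h _ _ (att N) tv vc; rewrite -/e ltNge => /negP; apply.
  apply: le_trans (GXz N (lt_le_trans (lt_trans tv vc) c2u)) _.
  apply: le_trans (HG N) _; rewrite -/(s N).
  have : s N ^+ 2 < e / 2 / (B + 1).
    by rewrite -(ltr_pM2l c0); have := tsq N; rewrite /d in td; lra.
  rewrite ltr_pdivlMr// => h2; have := sqr_ge0 (s N); nra.
pose cc := Num.min c1 c2.
have acc : a < cc by rewrite lt_min ac1.
have [N hN] := ta cc acc.
have hN1 r : (N <= r)%N -> t r < c1 by move=> /hN; rewrite lt_min => /andP[].
have hN2 r : (N <= r)%N -> t r < c2 by move=> /hN; rewrite lt_min => /andP[].
have hNu r : (N <= r)%N -> t r < u by move=> /hN1/lt_le_trans; apply.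
pose d r := dist1 (X (t r.+1)) (X (t r)).
have mcc i : monotone_on (fun v => X v i) a cc.
  by apply: monotone_on_sub (mX i); rewrite ge_min lexx.
have bound r : (N <= r)%N -> s r <= K * Num.sqrt B / c * d r.
  move=> Nr; have d0 : 0 <= d r by exact: dist1_ge0.
  have [sr0|sr0] := eqVneq (s r) 0.
    by rewrite sr0 mulr_ge0// divr_ge0 ?mulr_ge0 ?sqrtr_ge0// ltW.
  have srgt : 0 < s r by rewrite lt_neqAle eq_sym sr0 s0.
  have tlt : t r.+1 < t r.
    rewrite -subr_gt0; apply: lt_le_trans (Hdec r); rewrite mulr_gt0//.
    by rewrite exprn_gt0.
  have trd : t r - t r.+1 <= K * Num.sqrt (G (X (t r))) * d r.
    apply: (monotone_length_bound (m := fun v => K * Num.sqrt (G (X v))) mcc L0).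
    - by move=> p; rewrite mulr_ge0// sqrtr_ge0.
    - move=> p q ap pq qc; apply: ler_wpM2l => //; apply: ler_wsqrtr.
      by apply: Gincr => //; apply: lt_le_trans qc _; rewrite ge_min lexx orbT.
    - move=> p q ap pq qc.
      have qu : q < u by apply: lt_le_trans qc _; rewrite ge_min c1u.
      have pau : a < p < u by rewrite ap (lt_trans pq).
      have qau : a < q < u by rewrite qu (lt_trans ap).
      have [_ fp] := hX p pau; have [_ fq] := hX q qau.
      by rewrite -{1}fq -{1}fp; apply: Hlip; exact: XM.
    - exact: att.
    - exact: tlt.
    - exact: hN.
  rewrite -(ler_pM2l (mulr_gt0 c0 srgt)).
  rewrite -mulrA -expr2 (le_trans (Hdec r))// (le_trans trd)//.
  rewrite (_ : _ * _ * (_ * _) = K * (Num.sqrt B * s r) * d r); last first.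
    by field; rewrite gt_eqF.
  apply: ler_wpM2r => //; apply: ler_wpM2l => //; apply: le_trans (sqG r).
  by apply: ler_wsqrtr; apply: GXz; exact: hNu.
apply: (tailP N (K * Num.sqrt B / c * W)) => n.
apply: (@le_trans _ _ (K * Num.sqrt B / c * \sum_(r < n) d (N + r)%N)).
  rewrite mulr_sumr; apply: ler_sum => r _; apply: bound; exact: leq_addr.
apply: ler_wpM2l; first by rewrite divr_ge0 ?mulr_ge0 ?sqrtr_ge0// ltW.
suff -> : \sum_(r < n) d (N + r)%N = dist1 (X (t (N + n)%N)) (X (t N)).
  by apply: distW; apply: XM; rewrite att hNu// leq_addr.
elim: n => [|n IH].
  by rewrite big_ord0 addn0 /dist1 big1// => i _; rewrite subrr normr0.
rewrite big_ord_recr /= IH addrC addnS; apply/esym.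
apply: (monotone_on_dist1 mcc) => //; first by apply: tmono; exact: leq_addr.
exact: hN.
Qed.
End FiniteLength.

Section Convergence.
Variables (R : realType) (I : finType).

Lemma polyfun_cvg (g : (I -> R) -> R) (z : nat -> I -> R) (x : I -> R) :
  polyfun g -> (forall i, (fun r => z r i) @ \oo --> x i) ->
  (fun r => g (z r)) @ \oo --> g x.
Proof.
move=> pg zx; elim: pg => [c|i|f h _ IHf _ IHh|f h _ IHf _ IHh].
- exact: cvg_cst.
- exact: zx.
- exact: (cvgD IHf IHh).
- exact: (cvgM IHf IHh).
Qed.

Lemma cvg_of_bounded_variation (u : nat -> R) (S : R) :
  (forall n, \sum_(r < n) `|u r.+1 - u r| <= S) -> exists l : R, u @ \oo --> l.
Proof.
move=> hS.
have : cvgn [normed series (telescope u)].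
  apply: nondecreasing_is_cvgn.
    by apply: nondecreasing_series => n _ _; exact: normr_ge0.
  exists S => _ [n _ <-] /=; apply: le_trans (hS n).
    by rewrite seriesEnat /= big_mkord.
move/normed_cvg/cvg_ex => [l hl]; exists (l + u 0%N).
have E : (fun n => series (telescope u) n + u 0%N) = u.
  apply: funext => n; rewrite -[RHS](subrK (u 0%N)); congr (_ + _).
  by rewrite seriesEnat /= telescope_sumr.
rewrite -[X in X @ _]E.
by apply: (cvgD hl); exact: cvg_cst.
Qed.

Lemma descent_cvg (f G Q : (I -> R) -> R) (b K L B c : R)
    (z : nat -> I -> R) (M : set (I -> R)) :
  M = [set x | (forall i, - b <= x i <= b) /\ Q x = 0] ->
  polyfun f -> polyfun G -> polyfun Q ->
  0 <= K -> 0 <= L -> 0 <= B -> 0 < c ->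
  (forall x, M x -> 0 <= G x) ->
  (forall x y, M x -> M y ->
    f y - f x <= (K * Num.sqrt (G x) + L * dist1 x y) * dist1 x y) ->
  (forall r, M (z r)) ->
  (forall r, c * dist1 (z r) (z r.+1) ^+ 2 <= f (z r) - f (z r.+1)) ->
  (forall r, G (z r) <= B * dist1 (z r) (z r.+1) ^+ 2) ->
  exists x, [/\ M x, G x = 0 & forall i, (fun r => z r i) @ \oo --> x i].
Proof.
move=> EM_ pf pG pQ K0 L0 B0 c0 G0 Hlip Mz Hdec HG.
have [S hS] := finite_length_sequence EM_ pf pG pQ K0 L0 B0 c0 G0 Hlip Mz Hdec HG.
have /choice[x zx] : forall i, exists l : R, (fun r => z r i) @ \oo --> l.
  move=> i; apply: (@cvg_of_bounded_variation _ S) => n.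
  apply: le_trans (hS n); apply: ler_sum => r _.
  by rewrite /dist1 (bigD1 i)//= lerDl sumr_ge0.
have zf := polyfun_cvg pf zx; have zG := polyfun_cvg pG zx.
have zQ := polyfun_cvg pQ zx.
have Mx : M x.
  rewrite EM_; split.
    move=> i; have Mzi r : - b <= z r i <= b by have := Mz r; rewrite EM_ => -[].
    apply/andP; split.
      by apply: (cvgr_to_ge (zx i)); apply: nearW => r; case/andP: (Mzi r).
    by apply: (cvgr_to_le (zx i)); apply: nearW => r; case/andP: (Mzi r).
  have Qz r : Q (z r) = 0 by have := Mz r; rewrite EM_ => -[].
  apply/eqP; rewrite eq_le; apply/andP; split.
    by apply: (cvgr_to_le zQ); apply: nearW => r; rewrite Qz.
  by apply: (cvgr_to_ge zQ); apply: nearW => r; rewrite Qz.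
exists x; split=> //; apply/eqP; rewrite eq_le G0// andbT.
pose w r := B / c * (f (z r) - f (z r.+1)).
have zfS : (fun r => f (z r.+1)) @ \oo --> f x by rewrite (cvg_shiftS (fun r => f (z r))).
have w0 : w @ \oo --> B / c * (f x - f x).
  by apply: cvgM; [exact: cvg_cst|exact: (cvgB zf zfS)].
rewrite subrr mulr0 in w0.
apply: (ler_cvg_to zG w0).
apply: nearW => r; apply: le_trans (HG r) _.
rewrite /w -mulrA ler_wpM2l// mulrC ler_pdivlMr// mulrC.
exact: Hdec.
Qed.
End Convergence.

(** * Quadratic forms on a product of spheres *)

Section Quadratic.
Variables (R : realType) (k n : nat) (C : 'M[R]_n).
Hypothesis Csym : C^T = C.
Local Notation I := ('I_k * 'I_n)%type.
Implicit Types (x y d : I -> R) (p : I) (V : 'M[R]_(k, n)).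

Definition grad x p : R := \sum_j C p.2 j * x (p.1, j).

Definition quad x : R := \sum_p x p * grad x p.

Definition multiplier x (i : 'I_n) : R := \sum_l grad x (l, i) * x (l, i).

Definition tangent x p : R := grad x p - multiplier x p.2 * x p.

Definition coords V : I -> R := fun p => V p.1 p.2.

Definition unit_pt x : Prop := forall i, \sum_l x (l, i) ^+ 2 = 1.

Definition absC : R := \sum_i \sum_j `|C i j|.

Lemma absC_ge0 : 0 <= absC.
Proof. by apply: sumr_ge0 => i _; apply: sumr_ge0 => j _. Qed.

Lemma sum_pair (F : I -> R) : \sum_p F p = \sum_i \sum_l F (l, i).
Proof.
by rewrite exchange_big pair_bigA; apply: eq_bigr => -[].
Qed.

Lemma gvecE V i a : gvec C V i a 0 = grad (coords V) (a, i).
Proof.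
by rewrite /gvec summxE; apply: eq_bigr => j _; rewrite !mxE.
Qed.

Lemma objE V : obj C V = quad (coords V).
Proof.
rewrite /quad sum_pair; apply: eq_bigr => i _.
under eq_bigr do rewrite mxE mulr_sumr.
rewrite exchange_big /=; apply: eq_bigr => l _.
rewrite mulr_sumr; apply: eq_bigr => j _; rewrite mxE /coords /=.
by rewrite mulrCA.
Qed.

Lemma unit_colsP V : unit_cols V <-> unit_pt (coords V).
Proof.
have E i : vnorm (col i V) = Num.sqrt (\sum_l coords V (l, i) ^+ 2).
  by congr Num.sqrt; apply: eq_bigr => l _; rewrite mxE.
split=> h i; last by rewrite E h sqrtr1.
have := h i; rewrite E => /(congr1 (fun u => u ^+ 2)).
by rewrite expr1n sqr_sqrtr// sumr_ge0// => l _; exact: sqr_ge0.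
Qed.

Lemma gradB x y p : grad (fun p => y p - x p) p = grad y p - grad x p.
Proof.
by rewrite /grad -sumrB; apply: eq_bigr => j _; rewrite mulrBr.
Qed.

Lemma grad_le d p t : (forall q, `|d q| <= t) -> `|grad d p| <= absC * t.
Proof.
move=> dt; apply: le_trans (ler_norm_sum _ _ _) _.
have t0 : 0 <= t by exact: le_trans (dt p).
apply: (@le_trans _ _ (\sum_j `|C p.2 j| * t)).
  by apply: ler_sum => j _; rewrite normrM ler_wpM2l.
rewrite -mulr_suml ler_wpM2r// /absC [leRHS](bigD1 p.2)//= lerDl.
by apply: sumr_ge0 => i _; apply: sumr_ge0.
Qed.

Lemma grad_sym x y : \sum_p x p * grad y p = \sum_p y p * grad x p.
Proof.
have E z w : \sum_p z p * grad w p =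
    \sum_l \sum_i \sum_j C i j * (z (l, i) * w (l, j)).
  rewrite sum_pair exchange_big; apply: eq_bigr => l _; apply: eq_bigr => i _.
  by rewrite mulr_sumr; apply: eq_bigr => j _; rewrite mulrCA.
rewrite !E; apply: eq_bigr => l _; rewrite exchange_big.
apply: eq_bigr => i _; apply: eq_bigr => j _.
by rewrite -{1}Csym mxE [x _ * _]mulrC.
Qed.

Lemma quad_expand x y :
  quad y - quad x = 2 * (\sum_p grad x p * (y p - x p))
    + quad (fun p => y p - x p).
Proof.
have E : \sum_p x p * grad y p = \sum_p y p * grad x p by exact: grad_sym.
have -> : quad (fun p => y p - x p) =
    quad y - \sum_p y p * grad x p - \sum_p x p * grad y p + quad x.
  rewrite /quad -!sumrB -big_split /=; apply: eq_bigr => p _; rewrite gradB; ring.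
have -> : \sum_p grad x p * (y p - x p) = \sum_p y p * grad x p - quad x.
  rewrite /quad -sumrB; apply: eq_bigr => p _; ring.
by rewrite E; ring.
Qed.

Lemma sum_unit x (w : 'I_n -> R) : unit_pt x ->
  \sum_p w p.2 * x p ^+ 2 = \sum_i w i.
Proof.
move=> ux; rewrite sum_pair; apply: eq_bigr => i _ /=.
by rewrite -mulr_sumr ux mulr1.
Qed.

Lemma unit_pt_le1 x p : unit_pt x -> - 1 <= x p <= 1.
Proof.
case: p => l i ux; rewrite -ler_norml -[1]sqrtr1 -(ux i) -sqrtr_sqr.
by rewrite ler_wsqrtr// (bigD1 l)//= lerDl sumr_ge0// => j _; exact: sqr_ge0.
Qed.

Lemma unit_pt_norm x p : unit_pt x -> `|x p| <= 1.
Proof. by move=> ux; rewrite ler_norml; exact: unit_pt_le1. Qed.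

Lemma multiplier_le x i : unit_pt x -> `|multiplier x i| <= k%:R * absC.
Proof.
move=> ux; apply: le_trans (ler_norm_sum _ _ _) _.
apply: (@le_trans _ _ (\sum_(l < k) absC)); last first.
  by rewrite sumr_const card_ord mulr_natl.
apply: ler_sum => l _; rewrite normrM -[leRHS]mulr1.
apply: ler_pM => //; last exact: unit_pt_norm.
by rewrite -[leRHS]mulr1; apply: grad_le => q; exact: unit_pt_norm.
Qed.

Lemma coord_le_dist1 x y p : `|y p - x p| <= dist1 x y.
Proof. by rewrite /dist1 (bigD1 p)//= lerDl sumr_ge0. Qed.

Definition tangent_sq x : R := \sum_p tangent x p * tangent x p.

Lemma tangent_sq_ge0 x : 0 <= tangent_sq x.
Proof. by apply: sumr_ge0 => p _; rewrite -expr2 sqr_ge0. Qed.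

Lemma tangent_le x p : `|tangent x p| <= Num.sqrt (tangent_sq x).
Proof.
rewrite -sqrtr_sqr ler_wsqrtr// /tangent_sq (bigD1 p)//= -expr2 lerDl.
by apply: sumr_ge0 => q _; rewrite -expr2 sqr_ge0.
Qed.

(* Moving along the product of spheres, the normal part of the gradient only
   contributes to second order, since 2 <x_i, y_i - x_i> = - |y_i - x_i|^2. *)
Lemma quad_increment_le x y : unit_pt x -> unit_pt y ->
  quad y - quad x <= (2 * Num.sqrt (tangent_sq x)
    + (k.+1%:R * absC) * dist1 x y) * dist1 x y.
Proof.
move=> ux uy; pose d p := y p - x p; set D := dist1 x y.
have -> : quad y - quad x = 2 * (\sum_p tangent x p * d p)
    - (\sum_p multiplier x p.2 * d p ^+ 2) + quad d.
  rewrite quad_expand; congr (_ + _).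
  have e0 := sum_unit (multiplier x) uy; rewrite -(sum_unit (multiplier x) ux) in e0.
  have e1 : \sum_p tangent x p * d p = \sum_p grad x p * (y p - x p)
      - \sum_p multiplier x p.2 * x p * d p.
    by rewrite -sumrB; apply: eq_bigr => p _; rewrite /tangent /d; ring.
  have e2 : \sum_p multiplier x p.2 * d p ^+ 2 =
      \sum_p multiplier x p.2 * y p ^+ 2 - \sum_p multiplier x p.2 * x p ^+ 2
      - 2 * \sum_p multiplier x p.2 * x p * d p.
    by rewrite mulr_sumr -!sumrB; apply: eq_bigr => p _; rewrite /d; ring.
  by rewrite e1 e2 e0; ring.
have D0 : 0 <= D by exact: dist1_ge0.
have dD p : `|d p| <= D by exact: coord_le_dist1.
have h1 : \sum_p tangent x p * d p <= Num.sqrt (tangent_sq x) * D.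
  rewrite /D /dist1 mulr_sumr; apply: ler_sum => p _.
  apply: le_trans (ler_norm _) _; rewrite normrM ler_wpM2r//.
  exact: tangent_le.
have h2 : - (\sum_p multiplier x p.2 * d p ^+ 2) <= k%:R * absC * D * D.
  rewrite -sumrN {2}/D /dist1 mulr_sumr; apply: ler_sum => p _.
  apply: le_trans (ler_norm _) _; rewrite normrN normrM expr2 normrM mulrA.
  rewrite ler_wpM2r//; apply: ler_pM => //; exact: multiplier_le.
have h3 : quad d <= absC * D * D.
  rewrite {2}/D /dist1 mulr_sumr; apply: ler_sum => p _.
  apply: le_trans (ler_norm _) _; rewrite normrM mulrC ler_wpM2r//.
  exact: grad_le.
rewrite mulrSr; lra.
Qed.

Lemma dist1_sqr_le x y :
  dist1 x y ^+ 2 <= #|{: I}|%:R * \sum_p (y p - x p) ^+ 2.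
Proof.
rewrite expr2 /dist1 mulr_suml.
apply: (@le_trans _ _ (\sum_p \sum_q
  ((y p - x p) ^+ 2 / 2 + (y q - x q) ^+ 2 / 2))).
  apply: ler_sum => p _; rewrite mulr_sumr; apply: ler_sum => q _.
  rewrite -[(y p - x p) ^+ 2]real_normK ?num_real//.
  rewrite -[(y q - x q) ^+ 2]real_normK ?num_real//.
  have := sqr_ge0 (`|y p - x p| - `|y q - x q|); rewrite sqrrB; lra.
pose N := #|{: I}|; pose S := \sum_p (y p - x p) ^+ 2; rewrite -/N -/S.
rewrite (eq_bigr (fun p => (y p - x p) ^+ 2 / 2 *+ N + S / 2)); last first.
  by move=> p _; rewrite big_split /= sumr_const -mulr_suml.
rewrite big_split /= sumr_const sumrMnl -mulr_suml -/S -/N -mulrnDl.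
by rewrite -splitr mulr_natl.
Qed.

Lemma polyfun_grad p : polyfun (grad^~ p).
Proof.
apply: polyfun_sum => j; apply: polyfun_mul; first exact: polyfun_const.
exact: polyfun_coord.
Qed.

Lemma polyfun_quad : polyfun quad.
Proof.
apply: polyfun_sum => p; apply: polyfun_mul; first exact: polyfun_coord.
exact: polyfun_grad.
Qed.

Lemma polyfun_tangent_sq : polyfun tangent_sq.
Proof.
have pt p : polyfun (tangent^~ p).
  apply: polyfun_sub; first exact: polyfun_grad.
  apply: polyfun_mul; last exact: polyfun_coord.
  apply: polyfun_sum => l; apply: polyfun_mul; first exact: polyfun_grad.
  exact: polyfun_coord.
by apply: polyfun_sum => p; apply: polyfun_mul.
Qed.

Definition unit_defect x : R :=
  \sum_i (\sum_l x (l, i) * x (l, i) - 1) * (\sum_l x (l, i) * x (l, i) - 1).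

Lemma polyfun_unit_defect : polyfun unit_defect.
Proof.
have pi_ i : polyfun (fun x => \sum_l x (l, i) * x (l, i) - 1).
  apply: polyfun_sub; last exact: polyfun_const.
  by apply: polyfun_sum => l; apply: polyfun_mul; exact: polyfun_coord.
by apply: polyfun_sum => i; apply: polyfun_mul.
Qed.

Lemma unit_ptE : unit_pt =
  [set x | (forall p, - 1 <= x p <= 1) /\ unit_defect x = 0].
Proof.
apply/seteqP; split=> x /=.
  move=> ux; split; first by move=> p; exact: unit_pt_le1.
  apply: big1 => i _; under eq_bigr do rewrite -expr2.
  by rewrite ux subrr mul0r.
move=> [_ /eqP]; rewrite psumr_eq0 => [|i _]; last by rewrite -expr2 sqr_ge0.
move=> /allP h i; have := h i (mem_index_enum i).
rewrite /= -expr2 sqrf_eq0 subr_eq0 => /eqP <-.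
by apply: eq_bigr => l _; rewrite expr2.
Qed.
End Quadratic.

(** * The Mixing method *)

Section Sweep.
Variables (R : realType) (k n : nat) (C : 'M[R]_n).
Implicit Types (V : 'M[R]_(k, n)) (i : 'I_n).

Definition partial_sweep V m := foldl (mix_update C) V (take m (enum 'I_n)).

Lemma partial_sweepS V i :
  partial_sweep V i.+1 = mix_update C (partial_sweep V i) i.
Proof.
rewrite /partial_sweep (take_nth i) ?size_enum_ord//.
by rewrite -cats1 foldl_cat nth_ord_enum.
Qed.

Lemma partial_sweep_full V : partial_sweep V n = mix_sweep C V.
Proof. by rewrite /partial_sweep take_oversize// size_enum_ord. Qed.

Lemma partial_sweep_ge V m a (b : 'I_n) : (m <= b)%N ->
  partial_sweep V m a b = V a b.
Proof.
elim: m => [|m IH] mb; first by rewrite /partial_sweep take0.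
have mn : (m < n)%N by exact: ltn_trans mb (ltn_ord b).
rewrite (partial_sweepS V (Ordinal mn)) mxE -val_eqE /= gtn_eqF//.
exact: IH (ltnW mb).
Qed.

Lemma partial_sweep_lt V m a (b : 'I_n) : (b < m <= n)%N ->
  partial_sweep V m a b = mix_sweep C V a b.
Proof.
move=> /andP[bm mn]; rewrite -partial_sweep_full.
have stable j : (m + j <= n)%N ->
    partial_sweep V (m + j) a b = partial_sweep V m a b.
  elim: j => [|j IH]; first by rewrite addn0.
  rewrite addnS => mjn; rewrite (partial_sweepS V (Ordinal mjn)) mxE.
  rewrite -val_eqE /= ltn_eqF ?IH ?(ltnW mjn)//.
  by rewrite (leq_trans bm)// leq_addr.
by have := stable (n - m)%N; rewrite subnKC// => ->.
Qed.

Hypothesis Csym : C^T = C.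
Hypothesis Cdiag : forall i, C i i = 0.

Section Step.
Variables (V : 'M[R]_(k, n)) (delta : R).
Hypotheses (uV : unit_pt (coords V)) (delta0 : 0 < delta).
Hypothesis nondeg : forall i, delta <= vnorm (gvec C (mix_inner C V i) i).

Let W := mix_sweep C V.
Let x := coords V.
Let y := coords W.
Let nu i := vnorm (gvec C (mix_inner C V i) i).
Let u m := coords (partial_sweep V m).

Let nu0 i : 0 < nu i. Proof. exact: lt_le_trans (nondeg i). Qed.

Let grad_stage a i : grad C (u i) (a, i) = - nu i * y (a, i).
Proof.
rewrite /y /coords /= /W -(@partial_sweep_lt V i.+1) ?ltnSn ?ltn_ord//.
rewrite partial_sweepS mxE eqxx !mxE -/(partial_sweep V i) gvecE.
by rewrite mulrNN mulVKf// gt_eqF.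
Qed.

Lemma unit_pt_sweep : unit_pt y.
Proof.
move=> i; have nu2 : nu i ^+ 2 = \sum_l grad C (u i) (l, i) ^+ 2.
  rewrite /nu /vnorm sqr_sqrtr; last by apply: sumr_ge0 => l _; exact: sqr_ge0.
  by apply: eq_bigr => l _; rewrite gvecE.
have n2 : nu i ^+ 2 != 0 by rewrite sqrf_eq0 gt_eqF.
apply: (mulfI n2); rewrite mulr1 [RHS]nu2 mulr_sumr; apply: eq_bigr => l _.
by rewrite grad_stage exprMn sqrrN.
Qed.

Lemma stage_decrease i : quad C (u i) - quad C (u i.+1) =
  nu i * \sum_a (y (a, i) - x (a, i)) ^+ 2.
Proof.
pose d p := u i.+1 p - u i p.
have d0 p : p.2 != i -> d p = 0.
  move=> pi_; rewrite /d /u /coords partial_sweepS mxE (negbTE pi_).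
  by rewrite subrr.
have di a : d (a, i) = y (a, i) - x (a, i).
  by rewrite /d /u /coords /= partial_sweep_lt ?ltnSn ?ltn_ord// partial_sweep_ge.
have qd : quad C d = 0.
  apply: big1 => p _; have [pi_|/d0 ->] := eqVneq p.2 i; last by rewrite mul0r.
  rewrite /grad big1 ?mulr0// => j _; have [->|ji] := eqVneq j i.
    by rewrite pi_ Cdiag mul0r.
  by rewrite (d0 (p.1, j)) ?mulr0.
have := quad_expand Csym (u i) (u i.+1); rewrite -/d qd addr0.
have -> : \sum_p grad C (u i) p * d p =
    \sum_a grad C (u i) (a, i) * (y (a, i) - x (a, i)).
  rewrite sum_pair (bigD1 i)//= [X in _ + X]big1 ?addr0.
    by apply: eq_bigr => a _; rewrite di.
  by move=> j ji; apply: big1 => a _; rewrite d0 ?mulr0.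
have norms : \sum_a (y (a, i) ^+ 2 - x (a, i) ^+ 2) = 0.
  by rewrite sumrB unit_pt_sweep uV subrr.
have -> : 2 * (\sum_a grad C (u i) (a, i) * (y (a, i) - x (a, i))) =
    - (nu i * \sum_a (y (a, i) - x (a, i)) ^+ 2)
    - nu i * \sum_a (y (a, i) ^+ 2 - x (a, i) ^+ 2).
  rewrite !mulr_sumr -sumrN -sumrB; apply: eq_bigr => a _.
  by rewrite grad_stage; ring.
by rewrite norms mulr0 subr0 => e; rewrite -opprB e opprK.
Qed.

Lemma sweep_decrease :
  delta * \sum_p (y p - x p) ^+ 2 <= quad C x - quad C y.
Proof.
pose e i := \sum_a (y (a, i) - x (a, i)) ^+ 2.
have e0 i : 0 <= e i by apply: sumr_ge0 => a _; exact: sqr_ge0.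
have H m : (m <= n)%N ->
    delta * \sum_(i < n | (i < m)%N) e i <= quad C x - quad C (u m).
  elim: m => [|m IH] mn.
    rewrite big_pred0// mulr0 /u /partial_sweep take0 subrr//.
  pose i := Ordinal mn.
  rewrite (bigD1 i)//=.
  have -> : \sum_(j < n | (j < m.+1)%N && (j != i)) e j =
      \sum_(j < n | (j < m)%N) e j.
    by apply: eq_bigl => j; rewrite -val_eqE /= ltnS ltn_neqAle andbC.
  rewrite mulrDr; have := IH (ltnW mn); have := stage_decrease i.
  have : delta * e i <= nu i * e i by rewrite ler_wpM2r//; exact: nondeg.
  rewrite /= -/(e i); lra.
have := H n (leqnn n); rewrite /u partial_sweep_full -/W -/y.
rewrite sum_pair; congr (_ * _ <= _).
by apply: eq_bigl => i; rewrite ltn_ord.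
Qed.

Lemma sweep_dist1_decrease :
  delta / #|{: 'I_k * 'I_n}|.+1%:R * dist1 x y ^+ 2 <= quad C x - quad C y.
Proof.
apply: le_trans sweep_decrease; rewrite -mulrA ler_pM2l//.
rewrite mulrC ler_pdivrMr ?ltr0n// mulrC.
apply: le_trans (dist1_sqr_le _ _) _; apply: ler_wpM2r.
  by apply: sumr_ge0 => p _; exact: sqr_ge0.
by rewrite ler_nat.
Qed.

Lemma tangent_sweep_le p :
  `|tangent C x p| <= k.+1%:R * (k.+1%:R * absC C) * dist1 x y.
Proof.
case: p => a i; set D := dist1 x y.
have D0 : 0 <= D by exact: dist1_ge0.
have A0 := absC_ge0 C.
have dD q : `|y q - x q| <= D by exact: coord_le_dist1.
pose rho l := grad C x (l, i) + nu i * x (l, i).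
have nule : nu i <= k%:R * absC C.
  have -> : nu i = \sum_l - (grad C (u i) (l, i) * y (l, i)).
    rewrite -[LHS]mulr1 -(unit_pt_sweep i) mulr_sumr.
    by apply: eq_bigr => l _; rewrite grad_stage; ring.
  rewrite mulr_natl -[in leRHS](card_ord k) -sumr_const; apply: ler_sum => l _.
  apply: le_trans (ler_norm _) _; rewrite normrN normrM -[leRHS]mulr1.
  apply: ler_pM => //; last exact: (unit_pt_norm _ unit_pt_sweep).
  rewrite -[leRHS]mulr1; apply: grad_le => -[b j]; rewrite /u /coords /=.
  case: (ltnP j i) => ji.
    rewrite partial_sweep_lt ?ji ?(ltnW (ltn_ord i))//.
    exact: (unit_pt_norm (b, j) unit_pt_sweep).
  by rewrite partial_sweep_ge//; exact: (unit_pt_norm (b, j) uV).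
have rhole l : `|rho l| <= k.+1%:R * absC C * D.
  have -> : rho l = - grad C (fun q => u i q - x q) (l, i)
      - nu i * (y (l, i) - x (l, i)).
    by rewrite gradB grad_stage /rho; ring.
  apply: le_trans (ler_normB _ _) _; rewrite normrN normrM.
  have h1 : `|grad C (fun q => u i q - x q) (l, i)| <= absC C * D.
    apply: grad_le => -[b j]; rewrite /u /coords /=.
    case: (ltnP j i) => ji; last by rewrite partial_sweep_ge// subrr normr0.
    rewrite partial_sweep_lt ?ji ?(ltnW (ltn_ord i))//.
    exact: (dD (b, j)).
  have h2 : `|nu i| * `|y (l, i) - x (l, i)| <= k%:R * absC C * D.
    by apply: ler_pM => //; rewrite gtr0_norm.
  by rewrite mulrSr; lra.
have -> : tangent C x (a, i) = rho a - (\sum_l rho l * x (l, i)) * x (a, i).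
  rewrite /tangent /multiplier /rho /=.
  under [in RHS]eq_bigr do rewrite mulrDl -mulrA -expr2.
  rewrite big_split /= -mulr_sumr uV; ring.
pose M := k.+1%:R * absC C * D.
have -> : k.+1%:R * (k.+1%:R * absC C) * D = M + k%:R * M.
  by rewrite /M -natr1; ring.
apply: le_trans (ler_normB _ _) _; apply: lerD; first exact: rhole.
rewrite normrM -[leRHS]mulr1.
apply: ler_pM => //; last exact: (unit_pt_norm _ uV).
apply: le_trans (ler_norm_sum _ _ _) _.
rewrite mulr_natl -[in leRHS](card_ord k) -sumr_const; apply: ler_sum => l _.
rewrite normrM -[leRHS]mulr1.
by apply: ler_pM => //; exact: (unit_pt_norm _ uV).
Qed.

Lemma tangent_sq_sweep_le : tangent_sq C x <=
  #|{: 'I_k * 'I_n}|%:R * (k.+1%:R * (k.+1%:R * absC C)) ^+ 2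
    * dist1 x y ^+ 2.
Proof.
rewrite -mulrA mulr_natl -sumr_const; apply: ler_sum => p _.
rewrite -expr2 -exprMn -[leLHS]real_normK ?num_real//.
by rewrite lerXn2r ?nnegrE ?(le_trans (normr_ge0 _) (tangent_sweep_le p))//
  tangent_sweep_le.
Qed.
End Step.
End Sweep.

Theorem theorem1 (R : realType) (k n : nat) (C : 'M[R]_n) (V0 : 'M[R]_(k, n))
  (delta : R) :
  C^T = C ->
  (forall i : 'I_n, C i i = 0) ->
  unit_cols V0 ->
  0 < delta ->
  (forall (r : nat) (i : 'I_n),
      delta <= vnorm (gvec C (mix_inner C (mix_iter C V0 r) i) i)) ->
  (forall r : nat,
      obj C (mix_iter C V0 r.+1) <= obj C (mix_iter C V0 r) /\
      (mix_iter C V0 r.+1 <> mix_iter C V0 r ->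
         obj C (mix_iter C V0 r.+1) < obj C (mix_iter C V0 r))) /\
  exists Vs : 'M[R]_(k, n),
    first_order_critical C Vs /\
    forall (a : 'I_k) (b : 'I_n), (fun r : nat => mix_iter C V0 r a b) @ \oo --> Vs a b.
Proof.
move=> Csym Cdiag uV0 delta0 nondeg.
pose z r := coords (mix_iter C V0 r).
have iterS r : mix_iter C V0 r.+1 = mix_sweep C (mix_iter C V0 r) by [].
have uz r : unit_pt (z r).
  elim: r => [|r IH]; first exact/unit_colsP.
  by rewrite /z iterS; exact: (unit_pt_sweep delta0 (nondeg r)).
have dec r : delta * \sum_p (z r.+1 p - z r p) ^+ 2 <=
    quad C (z r) - quad C (z r.+1).
  exact: (sweep_decrease Csym Cdiag (uz r) delta0 (nondeg r)).
split=> [r|].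
  rewrite !objE -/(z r) -/(z r.+1).
  have S0 : 0 <= \sum_p (z r.+1 p - z r p) ^+ 2.
    by apply: sumr_ge0 => p _; exact: sqr_ge0.
  split; first by rewrite -subr_ge0; apply: le_trans (dec r); rewrite mulr_ge0// ltW.
  move=> neq; rewrite -subr_gt0; apply: lt_le_trans (dec r); rewrite mulr_gt0//.
  rewrite lt_neqAle S0 andbT eq_sym psumr_eq0 => [|p _]; last exact: sqr_ge0.
  apply/allP => eqz; apply: neq; apply/matrixP => a b.
  have := eqz (a, b) (mem_index_enum _).
  by rewrite /= sqrf_eq0 subr_eq0 => /eqP.
have N0 : 0 < delta / #|{: 'I_k * 'I_n}|.+1%:R by rewrite divr_gt0// ltr0n.
have A0 := absC_ge0 C.
have L0 : 0 <= k.+1%:R * absC C by rewrite mulr_ge0.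
have B0 : 0 <= #|{: 'I_k * 'I_n}|%:R * (k.+1%:R * (k.+1%:R * absC C)) ^+ 2.
  by rewrite mulr_ge0// sqr_ge0.
have [x [ux Gx zx]] := descent_cvg (@unit_ptE R k n)
  (polyfun_quad k C) (polyfun_tangent_sq k C) (polyfun_unit_defect R k n)
  (ler0n R 2) L0 B0 N0 (fun x _ => tangent_sq_ge0 C x)
  (@quad_increment_le R k n C Csym) uz
  (fun r => sweep_dist1_decrease Csym Cdiag (uz r) delta0 (nondeg r))
  (fun r => tangent_sq_sweep_le (uz r) delta0 (nondeg r)).
pose Vs := \matrix_(a < k, b < n) x (a, b).
have cVs : coords Vs = x by apply: funext => -[a b]; rewrite /coords mxE.
exists Vs; split; last by move=> a b; rewrite mxE; exact: (zx (a, b)).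
split; first by apply/unit_colsP; rewrite cVs.
exists (multiplier C x) => i; apply/colP => a; rewrite gvecE !mxE cVs.
have := tangent_le C x (a, i); rewrite Gx sqrtr0 normr_le0 subr_eq0.
by move=> /eqP.
Qed.
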